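(* The following are equivalent for a separable Banach space $E$: (1) The space $\mathbf{G}[E]$ exists, i.e., there exists a separable Gurarij space containing $E$ (isometrically) which is atomic over $E$. (2) For each $n$, the set of isolated types in $S_n(E)$ is dense (in the topology of $S_n(E)$). (3) The set of isolated types in $S_1(E)$ is dense (in the topology of $S_1(E)$).
   Context: All spaces are real; embeddings of normed spaces are linear and isometric. Types. For a Banach space $E$ and $n \in \mathbb{N}$, let $E(n) = E \oplus \bigoplus_{i<n} \mathbb{R} x_i$, with formal variables $x_i$. The space of $n$-types $S_n(E)$ is the set of all semi-norms on $E(n)$ extending the norm of $E$; the semi-norm corresponding to $\xi \in S_n(E)$ is written $\|\cdot\|^\xi$. If $E \subseteq F$ are Banach spaces and $\bar a \in F^n$, then $\mathrm{tp}(\bar a/E) \in S_n(E)$ is the semi-norm $b + \sum \lambda_i x_i \mapsto \| b + \sum \lambda_i a_i \|$; $\bar a$ realises $\xi$ if $\xi = \mathrm{tp}(\bar a/E)$. The topology on $S_n(E)$ is the least one making $\xi \mapsto \|x\|^\xi$ continuous for every $x \in E(n)$. The distance $d(\xi,\zeta)$ is the infimum, over all Banach spaces $F \supseteq E$ and all realisations $\bar a,\bar b \in F^n$ of $\xi,\zeta$ respectively, of $\sup_i \|a_i - b_i\|$. A type $\xi$ is isolated if every metric neighbourhood of $\xi$ is also a neighbourhood of $\xi$ in the topology. For $E \subseteq F$, $F$ is atomic over $E$ if the type over $E$ of every finite tuple in $F$ is isolated. A Gurarij space is a Banach space $G$ such that for any $\varepsilon > 0$, finite-dimensional Banach spaces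 $E \subseteq F$ and isometric embedding $\varphi \colon E \to G$, there is a linear map $\psi \colon F \to G$ extending $\varphi$ with $(1-\varepsilon)\|x\| \leq \|\psi x\| \leq (1+\varepsilon)\|x\|$ for all $x \in F$. *)

(* Defs.v *)
From HB Require Import structures.
From mathcomp Require Import all_boot all_order all_algebra.
From mathcomp Require Import all_classical all_reals.
From mathcomp Require Import ereal topology normedtype.

Set Implicit Arguments.
Unset Strict Implicit.
Unset Printing Implicit Defensive.

Import Order.TTheory GRing.Theory Num.Theory.
Import numFieldNormedType.Exports.

Local Open Scope classical_set_scope.
Local Open Scope ring_scope.

Definition separable_space (T : topologicalType) : Prop :=
  exists2 D : set T, countable D & dense D.

(* An inclusion [E `<=` F] of Banach spaces is always represented by a linear
   isometry from E to F; nothing is identified with its image. *)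
Record embedding (R : realType) (E F : normedModType R) := Embedding {
  embedding_fun :> {linear E -> F};
  embedding_isometry : forall x, `|embedding_fun x| = `|x| }.

Definition finite_dimensional (R : realType) (V : lmodType R) : Prop :=
  exists (n : nat) (v : 'I_n -> V),
    forall x, exists c : 'I_n -> R, x = \sum_(i < n) c i *: v i.

(* Nonnegativity follows from these two properties. *)
Definition seminorm (R : realType) (V : lmodType R) (p : V -> R) : Prop :=
  (forall (a : R) x, p (a *: x) = `|a| * p x) /\
  (forall x y, p (x + y) <= p x + p y).

Section Types.
Variable R : realType.
Implicit Types (E F : completeNormedModType R) (n : nat).

(* The pair (b, l) stands for b + \sum_(i < n) l 0 i x_i in the space E(n). *)
Definition free_ext E n : lmodType R := (E * 'rV[R]_n)%type.

Record ntype E n := NType {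
  ntype_norm :> free_ext E n -> R;
  ntype_seminorm : seminorm ntype_norm;
  ntype_extends : forall b : E, ntype_norm (b, 0) = `|b| }.

HB.instance Definition _ E n := gen_eqMixin (ntype E n).
HB.instance Definition _ E n := gen_choiceMixin (ntype E n).

(* The supremum, over v in E(n), of the initial topologies of xi |-> xi v. *)
Definition ntype_topology E n : Type :=
  sup_topology (fun v : free_ext E n =>
    Topological.on (initial_topology (fun xi : ntype E n => xi v : R))).
HB.instance Definition _ E n :=
  Topological.copy (ntype E n) (ntype_topology E n).

Section Realisation.
Variables (E F : completeNormedModType R) (i : embedding E F).
Variables (n : nat) (a : 'I_n -> F).

Definition tp_norm (v : free_ext E n) : R :=
  `|i v.1 + \sum_(k < n) v.2 0 k *: a k|.

Lemma tp_norm_seminorm : seminorm tp_norm.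
Proof.
split=> [c x|x y]; rewrite /tp_norm /=.
  rewrite linearZ /= -normrZ scalerDr scaler_sumr; congr (`|_ + _|).
  by apply: eq_bigr => k _; rewrite mxE scalerA.
rewrite linearD /= -[X in `|_ + X|]/(\sum_(k < n) (x.2 + y.2) 0 k *: a k).
have -> : \sum_(k < n) (x.2 + y.2) 0 k *: a k =
    \sum_(k < n) x.2 0 k *: a k + \sum_(k < n) y.2 0 k *: a k.
  by rewrite -big_split; apply: eq_bigr => k _; rewrite mxE scalerDl.
by rewrite addrACA ler_normD.
Qed.

Lemma tp_norm_extends (b : E) : tp_norm (b, 0) = `|b|.
Proof.
rewrite /tp_norm /= big1 ?addr0 ?embedding_isometry // => k _.
by rewrite mxE scale0r.
Qed.

Definition tp : ntype E n := NType tp_norm_seminorm tp_norm_extends.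

End Realisation.

Definition realises E F (i : embedding E F) n (a : 'I_n -> F)
  (xi : ntype E n) : Prop := xi = tp i a.

Definition ntype_dist E n (xi zeta : ntype E n) : \bar R :=
  ereal_inf [set r | exists (F : completeNormedModType R) (i : embedding E F)
    (a b : 'I_n -> F), [/\ realises i a xi, realises i b zeta &
      r = (\big[Num.max/0]_(k < n) `|a k - b k|)%:E]].

Definition metric_nbhs E n (xi : ntype E n) (U : set (ntype E n)) : Prop :=
  exists2 e : R, 0 < e & [set zeta | (ntype_dist xi zeta < e%:E)%E] `<=` U.

Definition isolated_type E n (xi : ntype E n) : Prop :=
  forall U, metric_nbhs xi U -> nbhs xi U.

Definition atomic_over E F (i : embedding E F) : Prop :=
  forall n (a : 'I_n -> F), isolated_type (tp i a).

Definition gurarij (G : completeNormedModType R) : Prop :=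
  forall (e : R) (E F : completeNormedModType R) (j : embedding E F)
    (phi : embedding E G),
    0 < e -> finite_dimensional E -> finite_dimensional F ->
    exists psi : {linear F -> G},
      (forall x, psi (j x) = phi x) /\
      (forall x, (1 - e) * `|x| <= `|psi x| <= (1 + e) * `|x|).

End Types.

(* Main.v *)
Require Import Defs.
From HB Require Import structures.
From mathcomp Require Import all_boot all_order all_algebra.
From mathcomp Require Import all_classical all_reals.
From mathcomp Require Import ereal topology normedtype derive.
From mathcomp Require Import lra ring.

(** Why the theorem is true.

    Distances between types can be read off the semi-norms: xi and zeta are at
    distance at most r exactly when |xi (b, l) - zeta (b, l)| <= r * l1 l for
    all b and l.  Indeed the largest semi-norm that puts a realisation of xi
    within r of a realisation of zeta is an infimal convolution, and this
    inequality is what prevents it from collapsing either type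
    ([metric_amalgam]); its completion ([completion_exists]) is the required
    Banach space.  Hence a type is isolated when nearness at finitely many
    vectors forces nearness at all vectors, uniformly in the parameter b
    ([isolated_typeE]).

    Two facts bring everything down to 1-types.  First, an n-type is known
    from its restrictions to the lines spanned by vectors l of R^n and, the
    unit ball of R^n being compact, finitely many rational l suffice up to e;
    so F is atomic over E as soon as every single element of F has an isolated
    type ([norm_isolated_lines], [tp_isolated]).  Second, restricting
    semi-norms along a split injection is an open map ([open_restriction]): a
    semi-norm on the subspace that is close to the restriction of xi at
    finitely many points extends to a semi-norm close to xi.  An isolated
    1-type near the type of a vector can therefore be imposed on this vector,
    without disturbing finitely many other values.

    If G is Gurarij over E, the types realised in G are dense: a basic open
    set of types only involves a finite-dimensional piece of E, and the
    Gurarij property realises the type over this piece up to 1 + e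
    ([gurarij_types_dense]).  If G is moreover atomic, these types are
    isolated.

    Conversely, consider the semi-norms on E * {poly R} that extend the norm
    of E.  A Baire category argument ([generic_norm]) yields one of them, p,
    that satisfies each of countably many prescribed open conditions to which
    it is adherent.  One family of conditions says that a given vector of a
    countable dense set has a type with neighbourhoods of small diameter; when
    isolated 1-types are dense these conditions are dense by
    [open_restriction].  The other family says that some tuple realises,
    approximately, a finite rational description of a finite-dimensional
    extension; p is adherent to such a condition whenever the description is
    compatible with p, because the monomials of high degree leave room for new
    vectors ([extension_amalgam], [extends_norm_room]).  The completion of p
    is then separable and Gurarij ([generic_gurarij]).  Each of its elements
    is a limit of vectors with isolated types, and isolation passes to such
    limits ([norm_isolated_limit]), so it is atomic over E. *)

Set Implicit Arguments.
Unset Strict Implicit.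
Unset Printing Implicit Defensive.

Import Order.TTheory GRing.Theory Num.Theory.
Import numFieldNormedType.Exports.

Local Open Scope classical_set_scope.
Local Open Scope ring_scope.

(** * Preliminaries on real numbers *)

Lemma le_sum_mem (R : realType) (I : eqType) (s : seq I) (f : I -> R) i :
  (forall j, 0 <= f j) -> i \in s -> f i <= \sum_(j <- s) f j.
Proof.
move=> f0; elim: s => // j s IH; rewrite inE big_cons => /orP[/eqP ->|/IH h].
  by rewrite lerDl; apply: sumr_ge0.
by rewrite (le_trans h) // lerDr.
Qed.

Lemma margin (R : realType) (T : eqType) (s : seq T) (f : T -> R) (d : R) :
  (forall x, x \in s -> f x < d) ->
  exists r, 0 < r /\ forall x, x \in s -> f x + r <= d.
Proof.
elim: s => [|x s IH] h; first by exists 1.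
have [|r [r0 hr]] := IH; first by move=> y ys; apply: h; rewrite inE ys orbT.
have xd : f x < d by apply: h; exact: mem_head.
exists (Num.min r (d - f x)); split; first by rewrite lt_min r0 subr_gt0.
move=> y; rewrite inE => /orP[/eqP ->|ys].
  by rewrite -lerBrDl ge_min lexx orbT.
by rewrite (le_trans _ (hr y ys)) // lerD2l ge_min lexx.
Qed.

Lemma invS_le (R : realType) (x : R) : 0 < x -> exists m, m.+1%:R^-1 <= x.
Proof.
move=> x0; exists (Num.bound x^-1).
have h : x^-1 < (Num.bound x^-1)%:R by rewrite archi_boundP // invr_ge0 ltW.
rewrite -[leRHS]invrK lef_pV2 ?posrE ?invr_gt0 //.
by rewrite (le_trans (ltW h)) // ler_nat.
Qed.

Lemma rat_near (R : realType) (x e : R) : 0 < e -> exists r : rat, `|x - ratr r| <= e.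
Proof.
move=> e0; have [r] := @rat_in_itvoo R (x - e) (x + e) ltac:(lra).
rewrite in_itv /= => /andP[h1 h2]; exists r.
by rewrite ler_norml; apply/andP; split; lra.
Qed.

(** * Semi-norms, partial infima and linear combinations *)

Section SeminormTheory.
Variables (R : realType) (V : lmodType R).
Implicit Types (p q : V -> R).

Lemma seminorm0 p : seminorm p -> p 0 = 0.
Proof. by move=> [pZ _]; rewrite -(scale0r 0) pZ normr0 mul0r. Qed.

Lemma seminormN p x : seminorm p -> p (- x) = p x.
Proof. by move=> [pZ _]; rewrite -scaleN1r pZ normrN1 mul1r. Qed.

Lemma seminorm_ge0 p x : seminorm p -> 0 <= p x.
Proof.
move=> pS; have := pS.2 x (- x).
by rewrite subrr seminorm0 // seminormN // -mulr2n pmulrn_lge0.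
Qed.

Lemma seminormC p x y : seminorm p -> p (x - y) = p (y - x).
Proof. by move=> pS; rewrite -seminormN // opprB. Qed.

Lemma seminorm_dist p x y : seminorm p -> `|p x - p y| <= p (x - y).
Proof.
move=> pS; have := pS.2 (x - y) y; have := pS.2 (y - x) x.
by rewrite !subrK (seminormC y) // ler_norml => ? ?; apply/andP; split; lra.
Qed.

Lemma seminormD p q : seminorm p -> seminorm q -> seminorm (p \+ q).
Proof.
move=> [pZ pD] [qZ qD]; split=> [a x|x y] /=; first by rewrite pZ qZ mulrDr.
by rewrite addrACA lerD.
Qed.

Lemma seminormM p (r : R) : 0 <= r -> seminorm p -> seminorm (fun x => r * p x).
Proof.
move=> r0 [pZ pD]; split=> [a x|x y]; first by rewrite pZ mulrCA.
by rewrite -mulrDr ler_wpM2l.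
Qed.

Lemma seminorm_comp (U : lmodType R) (f : {linear U -> V}) p :
  seminorm p -> seminorm (p \o f).
Proof. by move=> [pZ pD]; split=> [a x|x y] /=; rewrite ?linearZ ?linearD ?pZ ?pD. Qed.

Lemma seminorm_sum p (I : Type) (s : seq I) (F : I -> V) :
  seminorm p -> p (\sum_(i <- s) F i) <= \sum_(i <- s) p (F i).
Proof.
move=> pS; elim: s => [|i s IH]; first by rewrite !big_nil seminorm0.
by rewrite !big_cons (le_trans (pS.2 _ _)) // lerD2l.
Qed.

End SeminormTheory.

Lemma seminorm_norm (R : realType) (V : normedModType R) :
  seminorm (fun x : V => `|x|).
Proof. by split=> [a x|x y]; rewrite ?normrZ ?ler_normD. Qed.

Section Infimum.
Variables (R : realType) (V K : lmodType R).

(** The shape of every amalgam below: a semi-norm on V * K that is a sum of the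
    semi-norms to be glued, evaluated at the parts of a decomposition indexed by
    K, is minimised over all decompositions. *)
Definition inf_snd (p : V * K -> R) (v : V) : R := inf [set p (v, k) | k in setT].

Variable p : V * K -> R.
Hypothesis pS : seminorm p.

Let has_inf_p v : has_inf [set p (v, k) | k in setT].
Proof.
split; first by exists (p (v, 0)), 0.
by exists 0 => _ [k _ <-]; exact: seminorm_ge0.
Qed.

Lemma inf_snd_le v k : inf_snd p v <= p (v, k).
Proof. by apply: ge_inf; [exact: (has_inf_p v).2|exists k]. Qed.

Lemma inf_snd_ge v m : (forall k, m <= p (v, k)) -> m <= inf_snd p v.
Proof.
by move=> h; apply: lb_le_inf; [exact: (has_inf_p v).1|move=> _ [k _ <-]].
Qed.

(** Infima of jointly subadditive functions are subadditive because
    decompositions of v and w add up to a decomposition of v + w. *)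
Lemma inf_snd_seminorm : seminorm (inf_snd p).
Proof.
have sub (a : R) v : a != 0 -> inf_snd p (a *: v) <= `|a| * inf_snd p v.
  move=> a0; rewrite mulrC -ler_pdivrMr ?normr_gt0 //; apply: inf_snd_ge => k.
  rewrite ler_pdivrMr ?normr_gt0 // mulrC -pS.1.
  exact: (le_trans (inf_snd_le _ (a *: k))).
split=> [a v|v w].
  have [->|a0] := eqVneq a 0.
    rewrite normr0 mul0r scale0r; apply/le_anti/andP.
    split; first by have := inf_snd_le 0 0; rewrite [p (0, 0)](seminorm0 pS).
    by apply: inf_snd_ge => k; exact: seminorm_ge0.
  apply/eqP; rewrite eq_le sub //= mulrC -ler_pdivlMr ?normr_gt0 //.
  have := sub a^-1 (a *: v); rewrite invr_eq0 a0 scalerA mulVf // scale1r.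
  by rewrite normfV mulrC; exact.
rewrite -lerBlDr; apply: inf_snd_ge => k.
rewrite lerBlDr -lerBlDl; apply: inf_snd_ge => l.
rewrite lerBlDl (le_trans (inf_snd_le _ (k + l))) //.
exact: (pS.2 (v, k) (w, l)).
Qed.

End Infimum.

Section LinearCombinations.
Variable R : realType.

Definition l1 n (c : 'rV[R]_n) : R := \sum_(k < n) `|c 0 k|.

Lemma l1_seminorm n : seminorm (@l1 n).
Proof.
split=> [a x|x y]; rewrite /l1.
  by rewrite mulr_sumr; apply: eq_bigr => k _; rewrite mxE normrM.
by rewrite -big_split ler_sum // => k _; rewrite mxE ler_normD.
Qed.

Lemma l1_coord n (c : 'rV[R]_n) i : `|c 0 i| <= l1 c.
Proof.
rewrite /l1 (bigD1 i) //= lerDl.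
by apply: sumr_ge0 => k _; exact: normr_ge0.
Qed.

Lemma l1_delta n (i : 'I_n) : l1 (delta_mx 0 i) = 1.
Proof.
rewrite /l1 (bigD1 i) //= big1 ?addr0 => [|k ki]; rewrite mxE eqxx.
  by rewrite eqxx normr1.
by rewrite (negbTE ki) normr0.
Qed.

Lemma l1_eq0 n (c : 'rV[R]_n) : l1 c = 0 -> c = 0.
Proof.
move=> /eqP; rewrite psumr_eq0 => [/allP h|k _]; last exact: normr_ge0.
apply/rowP => k; rewrite mxE; apply/eqP; rewrite -normr_eq0.
by apply: h; rewrite mem_index_enum.
Qed.

Variable V : lmodType R.

Definition lc n (a : 'I_n -> V) (c : 'rV[R]_n) : V := \sum_(k < n) c 0 k *: a k.

Lemma lc_is_linear n (a : 'I_n -> V) : linear (lc a).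
Proof.
move=> x u v; rewrite /lc scaler_sumr -big_split; apply: eq_bigr => k _ /=.
by rewrite !mxE scalerDl scalerA.
Qed.

HB.instance Definition _ n (a : 'I_n -> V) :=
  GRing.isLinear.Build R 'rV[R]_n V *:%R (lc a) (lc_is_linear a).

Lemma lc_delta n (a : 'I_n -> V) i : lc a (delta_mx 0 i) = a i.
Proof.
rewrite /lc (bigD1 i) //= big1 ?addr0 => [|k ki]; rewrite mxE eqxx.
  by rewrite eqxx scale1r.
by rewrite (negbTE ki) scale0r.
Qed.

Lemma seminorm_rV_le n (p : 'rV[R]_n -> R) B c : seminorm p ->
  (forall i, p (delta_mx 0 i) <= B) -> p c <= B * l1 c.
Proof.
move=> pS pB; rewrite [in X in p X](row_sum_delta c).
rewrite (le_trans (seminorm_sum _ _ pS)) //.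
rewrite mulr_sumr ler_sum // => k _.
by rewrite pS.1 mulrC ler_wpM2r.
Qed.

End LinearCombinations.

Lemma lc_linear (R : realType) (V W : lmodType R) (f : {linear V -> W}) n
  (a : 'I_n -> V) c : f (lc a c) = lc (f \o a) c.
Proof. by rewrite linear_sum; apply: eq_bigr => k _; rewrite linearZ. Qed.

(** * The Hahn-Banach theorem, through minimal sublinear functionals *)

Section HahnBanach.
Variables (R : realType) (V : lmodType R).
Implicit Types (p q : V -> R).

Definition sublinear q : Prop :=
  (forall x y, q (x + y) <= q x + q y) /\
  (forall t x, 0 < t -> q (t *: x) <= t * q x).

Lemma seminorm_sublinear p : seminorm p -> sublinear p.
Proof. by move=> [pZ pD]; split=> // t x t0; rewrite pZ gtr0_norm. Qed.

Lemma sublinear0 q : sublinear q -> q 0 = 0.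
Proof.
move=> [_ qZ]; have := qZ 2 0 ltac:(lra); have := qZ 2^-1 0 ltac:(lra).
rewrite !scaler0; lra.
Qed.

Lemma sublinear_geN q x : sublinear q -> - q (- x) <= q x.
Proof. by move=> qS; have := qS.1 x (- x); rewrite subrr sublinear0 //; lra. Qed.

Lemma inf_sublinear (S : V -> set R) :
    (forall x, has_inf (S x)) ->
    (forall x y a b, S x a -> S y b -> exists2 c, S (x + y) c & c <= a + b) ->
    (forall t x a, 0 < t -> S x a -> exists2 c, S (t *: x) c & c <= t * a) ->
  sublinear (fun x => inf (S x)).
Proof.
move=> Sinf SD SZ.
have infle x a : S x a -> inf (S x) <= a.
  by move=> ?; apply: ge_inf => //; exact: (Sinf x).2.
have leinf x m : (forall a, S x a -> m <= a) -> m <= inf (S x).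
  by move=> h; apply: lb_le_inf; [exact: (Sinf x).1|move=> a /h].
split=> [x y|t x t0].
  rewrite -lerBlDr; apply: (leinf) => a Sa; rewrite lerBlDr -lerBlDl.
  apply: (leinf) => b Sb; rewrite lerBlDl.
  by have [c /infle h1 h2] := SD _ _ _ _ Sa Sb; exact: le_trans h1 h2.
rewrite mulrC -ler_pdivrMr //; apply: (leinf) => a Sa; rewrite ler_pdivrMr // mulrC.
by have [c /infle h1 h2] := SZ _ _ _ t0 Sa; exact: le_trans h1 h2.
Qed.

(** The functional obtained from q by lowering the value at - y as much as
    sublinearity permits: t = 1 gives [tilt q y (- y) <= - q y], while t = 0
    gives [tilt q y <= q].  A minimal q equals all its tilts, which forces it
    to be additive. *)
Definition tilt q y x : R := inf [set q (x + t *: y) - t * q y | t in [set t | 0 <= t]].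

Lemma tilt_has_inf q y x : sublinear q ->
  has_inf [set q (x + t *: y) - t * q y | t in [set t | 0 <= t]].
Proof.
move=> qS; split; first by eexists; exists 0 => /=.
exists (- q (- x)) => _ [t /= t0 <-].
have := qS.1 (x + t *: y) (- x); rewrite addrC addKr => h.
suff : t * q y <= q (t *: y) by lra.
move: t0; rewrite le_eqVlt => /orP[/eqP <-|t0].
  by rewrite mul0r scale0r sublinear0.
have := qS.2 t^-1 (t *: y); rewrite invr_gt0 scalerA mulVf ?gt_eqF // scale1r.
by move=> /(_ t0); rewrite mulrC ler_pdivlMr // mulrC.
Qed.

Lemma tilt_le q y x t : sublinear q -> 0 <= t ->
  tilt q y x <= q (x + t *: y) - t * q y.
Proof. by move=> qS t0; apply: ge_inf; [exact: (tilt_has_inf y x qS).2|exists t]. Qed.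

Lemma tilt_sublinear q y : sublinear q -> sublinear (tilt q y).
Proof.
move=> qS; apply: inf_sublinear =>
  [x|x x' _ _ [s /= s0 <-] [t /= t0 <-]|s x _ s0 [t /= t0 <-]].
- exact: tilt_has_inf.
- eexists; first by exists (s + t) => //=; exact: addr_ge0.
  rewrite scalerDl addrACA mulrDl opprD [leRHS]addrACA lerD2r.
  exact: qS.1.
- eexists; first by exists (s * t) => //=; rewrite mulr_ge0 // ltW.
  by rewrite -scalerA -scalerDr mulrBr -mulrA lerD2r qS.2.
Qed.

(** Zorn's lemma applies because the infimum of a chain is sublinear: of two
    members of a chain, the smaller one bounds the infimum at x + y by the sum
    of their values at x and y. *)
Lemma minimal_sublinear p : sublinear p -> exists q,
  [/\ sublinear q, forall x, q x <= p x &
      forall q', sublinear q' -> (forall x, q' x <= q x) -> q' = q].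
Proof.
move=> pS; pose below q := sublinear q /\ forall x, q x <= p x.
pose T := {q | below q}.
pose le_T (q q' : T) := `[< forall x, sval q' x <= sval q x >].
have p_T : below p.
  by [].
have [|q r s qr rs|A Atot|q qmax] := @ZL_preorder T (exist _ p p_T) le_T.
- by move=> q; apply/asboolP.
- apply/asboolP => x; move/asboolP: qr => /(_ x); move/asboolP: rs => /(_ x).
  exact: le_trans.
- have [[q0 Aq0]|A0] := pselect (exists q : T, A q); last first.
    by exists (exist _ p p_T) => q Aq; case: A0; exists q.
  pose S x := [set sval r x | r in A].
  have Sinf x : has_inf (S x).
    split; first by exists (sval q0 x), q0.
    exists (- p (- x)) => _ [q _ <-]; case: (svalP q) => qS qp.
    by rewrite (le_trans _ (sublinear_geN _ qS)) // lerN2.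
  have infS : sublinear (fun x => inf (S x)).
    apply: inf_sublinear => // [x y _ _ [q Aq <-] [r Ar <-]|t x _ t0 [q Aq <-]].
      case: (Atot q r Aq Ar) => /asboolP h.
        exists (sval r (x + y)); first by exists r.
        by rewrite (le_trans ((svalP r).1.1 x y)) // lerD2r.
      exists (sval q (x + y)); first by exists q.
      by rewrite (le_trans ((svalP q).1.1 x y)) // lerD2l.
    exists (sval q (t *: x)); first by exists q.
    exact: (svalP q).1.2.
  have infle (q : T) x : A q -> inf (S x) <= sval q x.
    by move=> Aq; apply: ge_inf; [exact: (Sinf x).2|exists q].
  have infp x : inf (S x) <= p x.
    by exact: le_trans (infle q0 x Aq0) ((svalP q0).2 x).
  exists (exist below _ (conj infS infp)) => q Aq.
  by apply/asboolP => x; exact: infle.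
- exists (sval q); case: (svalP q) => qS qp; split=> // q' q'S q'q.
  have q'p x : q' x <= p x.
    by exact: le_trans (q'q x) (qp x).
  pose t' : T := exist below q' (conj q'S q'p).
  have /asboolP h := qmax t' ltac:(exact/asboolP).
  by apply/funext => x; apply/le_anti; rewrite q'q; exact: h.
Qed.

(** A minimal sublinear functional is linear; starting the minimisation from
    [tilt p v] instead of p forces the value p v at v. *)
Lemma hahn_banach p v : seminorm p -> exists l : V -> R^o,
  [/\ linear l, forall x, `|l x| <= p x & l v = p v].
Proof.
move=> pS; have pS' := seminorm_sublinear pS.
have [q [qS qle qmin]] := minimal_sublinear (tilt_sublinear v pS').
have qp x : q x <= p x.
  apply: le_trans (qle x) _; have := @tilt_le _ v x 0 pS' (lexx _).
  by rewrite scale0r addr0 mul0r subr0.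
have qv : p v <= q v.
  have := qle (- v); have := @tilt_le _ v (- v) 1 pS' ler01.
  rewrite scale1r addNr seminorm0 // mul1r; have := sublinear_geN v qS; lra.
have qD x y : q (x + y) = q x + q y.
  apply/le_anti; rewrite qS.1 /=.
  have := @tilt_le q y x 1 qS ler01; rewrite scale1r mul1r.
  rewrite (qmin (tilt q y)); first lra; first exact: tilt_sublinear.
  by move=> z; have := @tilt_le q y z 0 qS (lexx _); rewrite scale0r addr0 mul0r subr0.
have qN x : q (- x) = - q x.
  by apply/eqP; rewrite -addr_eq0 addrC -qD subrr sublinear0.
have qZ t x : 0 < t -> q (t *: x) = t * q x.
  move=> t0; apply/le_anti; rewrite qS.2 //=.
  by have := qS.2 t (- x) t0; rewrite scalerN !qN mulrN lerN2.
exists q; split=> [t x y|x|].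
- rewrite qD; congr (_ + _).
  case: (ltgtP t 0) => [t0|t0|->]; last 2 first.
  + exact: qZ.
  + by rewrite !scale0r sublinear0.
  by apply/oppr_inj; rewrite -qN -scaleNr qZ ?oppr_gt0 // mulNr.
- by rewrite ler_norml qp andbT lerNl -qN -(seminormN x pS) qp.
- by apply/le_anti; rewrite qp qv.
Qed.

End HahnBanach.

(** * The completion of a semi-normed space *)

Section Completion.
Variables (R : realType) (V : lmodType R) (p : V -> R) (pS : seminorm p).

(** The proof that p is a semi-norm is an argument of the type, since the
    normed structure put on the completion depends on it. *)
Definition dual_ball of seminorm p : Type :=
  {l : V -> R^o | linear l /\ forall x, `|l x| <= p x}.

Local Notation D := (dual_ball pS).

Definition evaluation (v : V) : D -> R^o := fun l => sval l v.

(** The completion is the closure, for uniform convergence on the dual ball, of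
    the functions that evaluate functionals at a vector of V.  Vectors of
    semi-norm 0 give the function 0, so the quotient by the kernel of p is
    taken at the same time, and all algebraic laws are inherited from
    functions. *)
Definition approximable : {pred D -> R^o} := fun g =>
  `[< forall e : R, 0 < e ->
      exists v, forall l, `|g l - evaluation v l| <= e >].

Lemma evaluation_linear : linear evaluation.
Proof. by move=> a x y; apply/funext => l; apply: (svalP l).1. Qed.

HB.instance Definition _ :=
  GRing.isLinear.Build R V (D -> R^o) *:%R evaluation evaluation_linear.

Lemma evaluation_approximable v : evaluation v \in approximable.
Proof. by apply/asboolP => e e0; exists v => l; rewrite subrr normr0 ltW. Qed.

Lemma approximable_submod : submod_closed approximable.
Proof.
split; first by rewrite -(linear0 evaluation) evaluation_approximable.
move=> a g h /asboolP gA /asboolP hA; apply/asboolP => e e0.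
have a0 : 0 < 2 * (`|a| + 1) by rewrite mulr_gt0 // ltr_wpDl.
have [v hv] := gA (e / (2 * (`|a| + 1))) ltac:(by rewrite divr_gt0).
have [w hw] := hA (e / 2) ltac:(by rewrite divr_gt0).
exists (a *: v + w) => l.
have -> : (a *: g + h) l - evaluation (a *: v + w) l =
    a * (g l - evaluation v l) + (h l - evaluation w l).
  rewrite linearP -[(a *: g + h) l]/(a * g l + h l).
  rewrite -[(_ + evaluation w) l]/(a * evaluation v l + evaluation w l).
  by ring.
rewrite (le_trans (ler_normD _ _)) // (splitr e) lerD ?hw //.
rewrite normrM (le_trans (ler_wpM2l (normr_ge0 a) (hv l))) //.
have -> : e / (2 * (`|a| + 1)) = (e / 2) / (`|a| + 1) by rewrite invfM mulrA.
rewrite mulrCA ler_piMr //; first by rewrite divr_ge0 // ltW.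
by rewrite ler_pdivrMr ?mul1r ?lerDl // ltr_wpDl.
Qed.

HB.instance Definition _ :=
  GRing.isSubmodClosed.Build R (D -> R^o) approximable
    (GRing.submod_closed_semi approximable_submod).

Record completion := Completion {
  completion_fun :> D -> R^o;
  completion_approximable : completion_fun \in approximable }.

HB.instance Definition _ := [isSub for completion_fun].
HB.instance Definition _ := [Choice of completion by <:].
HB.instance Definition _ := [SubChoice_isSubLmodule of completion by <:].

Definition completion_norm (g : completion) : R :=
  sup [set `|(g l : R)| | l in setT].

Lemma completion_has_sup (g : completion) : has_sup [set `|(g l : R)| | l in setT].
Proof.
split.
  have [l [ll lp _]] := hahn_banach 0 pS.
  by exists `|g (exist _ l (conj ll lp)) : R|, (exist _ l (conj ll lp)).
have /asboolP/(_ 1 ltr01)[v hv] := completion_approximable g.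
exists (1 + p v) => _ [l _ <-].
rewrite -[X in `|X|](subrK (evaluation v l)) (le_trans (ler_normD _ _)) // lerD //.
exact: (svalP l).2.
Qed.

Lemma completion_norm_ub (g : completion) l : `|(g l : R)| <= completion_norm g.
Proof. by apply: ub_le_sup; [exact: (completion_has_sup g).2|exists l]. Qed.

Lemma completion_norm_le (g : completion) m :
  (forall l, `|(g l : R)| <= m) -> completion_norm g <= m.
Proof.
by move=> h; apply: ge_sup; [exact: (completion_has_sup g).1|move=> _ [l _ <-]].
Qed.

Lemma completion_normD g h :
  completion_norm (g + h) <= completion_norm g + completion_norm h.
Proof.
apply: completion_norm_le => l; rewrite (le_trans (ler_normD _ _)) //.
by rewrite lerD // completion_norm_ub.
Qed.

Lemma completion_normZ a g : completion_norm (a *: g) = `|a| * completion_norm g.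
Proof.
have le b h : completion_norm (b *: h) <= `|b| * completion_norm h.
  apply: completion_norm_le => l; rewrite [X in `|X|](_ : _ = b * h l) //.
  by rewrite normrM ler_wpM2l // completion_norm_ub.
apply/le_anti; rewrite le /=; have [->|a0] := eqVneq a 0.
  have [_ [l _ _]] := (completion_has_sup g).1.
  by rewrite normr0 mul0r scale0r (le_trans _ (completion_norm_ub _ l)).
have := le a^-1 (a *: g).
by rewrite scalerA mulVf // scale1r normfV mulrC ler_pdivlMr ?normr_gt0 // mulrC.
Qed.

Lemma completion_norm_eq0 g : completion_norm g = 0 -> g = 0.
Proof.
move=> g0; apply/val_inj/funext => l; apply/eqP; rewrite -normr_le0 -g0.
exact: completion_norm_ub.
Qed.

HB.instance Definition _ := Lmodule_isNormed.Build R completion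
  completion_normD completion_normZ completion_norm_eq0.


Lemma completion_eval_dist (g h : completion) l : `|(g l : R) - h l| <= `|g - h|.
Proof. exact: (completion_norm_ub (g - h) l). Qed.

(** Cauchy filters converge pointwise, hence uniformly, and a uniform limit of
    approximable functions is approximable. *)
Lemma completion_complete (F : set_system completion) :
  ProperFilter F -> cauchy F -> cvg F.
Proof.
move=> FF /cauchyP Fc.
have ballE (g h : completion) e : ball g e h -> `|g - h| < e by rewrite -ball_normE.
have Fl (l : D) : cvg ((fun g : completion => g l : R) @ F).
  apply: cauchy_cvg; apply: cauchy_exP => e e0.
  have [g Fg] := Fc e e0; exists (g l).
  change (F ((fun h : completion => h l : R) @^-1` ball (g l : R) e)).
  apply: filterS Fg => h /ballE; rewrite -!ball_normE /=; apply: le_lt_trans.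
  exact: completion_eval_dist.
pose L l : R^o := lim ((fun g : completion => g l : R) @ F).
have LF (e : R) : 0 < e -> exists2 g : completion, F (ball g e) &
    forall l, `|L l - g l| <= e.
  move=> e0; have [g Fg] := Fc e e0; exists g => // l.
  have hc : (fun h : completion => `|(h l : R) - g l|) @ F --> `|(L l : R) - g l|.
    by apply: cvg_norm; apply: cvgB; [exact: Fl|exact: cvg_cst].
  apply: (cvgr_to_le hc); apply: filterS Fg => h /ballE gh.
  change (`|(h l : R) - g l| <= e); rewrite distrC.
  exact: (le_trans (completion_eval_dist _ _ _) (ltW gh)).
have LA : L \in approximable.
  apply/asboolP => e e0; have [|g _ gL] := LF (e / 2); first by rewrite divr_gt0.
  have /asboolP/(_ (e / 2))[|v hv] := completion_approximable g.
    by rewrite divr_gt0.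
  exists v => l; rewrite (le_trans (ler_distD (g l) _ _)) //.
  by rewrite (splitr e) lerD.
apply/cvg_ex; exists (Completion LA); apply/cvgrPdist_le => e e0.
have [|g Fg gL] := LF (e / 2); first by rewrite divr_gt0.
apply: filterS Fg => h /ballE gh; apply: completion_norm_le => l.
rewrite (le_trans (ler_distD (g l) _ _)) // (splitr e) lerD //.
exact: (le_trans (completion_eval_dist _ _ _) (ltW gh)).
Qed.

HB.instance Definition _ :=
  Uniform_isComplete.Build completion completion_complete.

Definition to_completion (v : V) : completion :=
  Completion (evaluation_approximable v).

Lemma to_completion_linear : linear to_completion.
Proof. by move=> a x y; apply/val_inj; exact: evaluation_linear. Qed.

HB.instance Definition _ :=
  GRing.isLinear.Build R V completion *:%R to_completion to_completion_linear.

(** The Hahn-Banach theorem enters here: some functional of the dual ball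
    attains p v. *)
Lemma norm_to_completion v : `|to_completion v| = p v.
Proof.
apply/le_anti/andP; split.
  by apply: completion_norm_le => l; exact: (svalP l).2.
have [l [ll lp lv]] := hahn_banach v pS.
have := completion_norm_ub (to_completion v) (exist _ l (conj ll lp)).
by apply: le_trans; rewrite /= /evaluation /= lv ler_norm.
Qed.

Lemma to_completion_dense (g : completion) (e : R) :
  0 < e -> exists v, `|g - to_completion v| <= e.
Proof.
move=> e0; have /asboolP/(_ e e0)[v hv] := completion_approximable g.
by exists v; apply: completion_norm_le.
Qed.

End Completion.

Theorem completion_exists (R : realType) (V : lmodType R) (p : V -> R) :
  seminorm p -> exists (B : completeNormedModType R) (f : {linear V -> B}),
    (forall v, `|f v| = p v) /\
    (forall (b : B) (e : R), 0 < e -> exists v, `|b - f v| <= e).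
Proof.
move=> pS; exists (completion pS : completeNormedModType R), (to_completion pS).
by split; [exact: norm_to_completion|exact: to_completion_dense].
Qed.

(** * Finite-dimensional spaces *)

Section FiniteDimension.
Variable R : realType.

Definition ratr_row N (g : 'rV[rat]_N) : 'rV[R]_N := map_mx ratr g.

Lemma ratr_row_delta N (i : 'I_N) : ratr_row (delta_mx 0 i) = delta_mx 0 i.
Proof. by apply/rowP => j; rewrite !mxE rmorph_nat. Qed.

Lemma l1_grid N (eta : R) : 0 < eta -> exists s : seq 'rV[rat]_N,
  forall c : 'rV[R]_N, l1 c <= 1 -> exists2 g, g \in s & l1 (c - ratr_row g) <= eta.
Proof.
move=> eta0.
(* Coordinates are rounded down to multiples of 1 / K, with N / K <= eta. *)
pose K := (Num.bound (N%:R / eta)).+1.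
have K0 : 0 < K%:R :> R by rewrite ltr0n.
pose pt (f : {ffun 'I_N -> 'I_(K + K).+1}) : 'rV[rat]_N :=
  \row_i (((f i)%:R - K%:R) / K%:R).
exists [seq pt f | f <- enum {: {ffun 'I_N -> 'I_(K + K).+1}}] => c c1.
have cK i : 0 <= (c 0 i + 1) * K%:R < (K + K).+1%:R.
  have : `|c 0 i| <= 1.
    by apply: le_trans c1; exact: l1_coord.
  rewrite ler_norml => /andP[h1 h2].
  have hc : 0 <= c 0 i + 1 by lra.
  rewrite mulr_ge0 ?(ltW K0) ?hc //=.
  have : (c 0 i + 1) * K%:R <= 2 * K%:R by rewrite ler_wpM2r ?(ltW K0) //; lra.
  by rewrite -[(K + K).+1%:R]natr1 natrD; lra.
pose f : {ffun 'I_N -> 'I_(K + K).+1} :=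
  [ffun i => inord (Num.truncn ((c 0 i + 1) * K%:R))].
exists (pt f); first by apply: map_f; rewrite mem_enum.
have cf i : `|(c - ratr_row (pt f)) 0 i| <= K%:R^-1.
  have /andP[h1 h2] := cK i; have /andP[h3 h4] := truncn_itv h1.
  rewrite !mxE ffunE fmorph_div rmorphB !rmorph_nat inordK ?truncn_lt_nat //.
  set t := Num.truncn _ in h3 h4 *.
  have -> : c 0 i - (t%:R - K%:R) / K%:R = ((c 0 i + 1) * K%:R - t%:R) / K%:R.
    by field; rewrite gt_eqF.
  rewrite normrM normfV (gtr0_norm K0) ler_piMl ?invr_ge0 ?ltW //.
  by move: h4; rewrite -natr1 ger0_norm ?subr_ge0 //; lra.
rewrite /l1 (le_trans (ler_sum _ (fun i _ => cf i))) //.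
rewrite sumr_const card_ord -[leLHS]mulr_natl.
rewrite ler_pdivrMr // mulrC -ler_pdivrMr //.
have : N%:R / eta < (Num.bound (N%:R / eta))%:R.
  by rewrite archi_boundP // divr_ge0 // ltW.
by rewrite /K -natr1; lra.
Qed.

(** Closeness on the lines through finitely many rational points implies
    closeness everywhere, at a rate independent of the parameter b.  The net
    contains the unit vectors, so p is bounded by B + d on them, and both
    semi-norms are Lipschitz on the unit ball of R^N with constants known in
    advance; homogeneity does the rest. *)
Lemma seminorm_net N (B e : R) : 0 <= B -> 0 < e ->
  exists (s : seq 'rV[rat]_N) (d : R), 0 < d /\
  forall (X : lmodType R) (p q : X * 'rV[R]_N -> R), seminorm p -> seminorm q ->
    (forall i, q (0, delta_mx 0 i) <= B) ->
    (forall g, g \in s -> forall b t,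
      `|p (b, t *: ratr_row g) - q (b, t *: ratr_row g)| <= d * `|t|) ->
  forall b c, `|p (b, c) - q (b, c)| <= e * l1 c.
Proof.
move=> B0 e0; pose M := 2 * B + 1.
have M0 : 0 < M by rewrite /M; lra.
have [|s hs] := @l1_grid N (e / (2 * M)); first by rewrite divr_gt0 // mulr_gt0.
exists (s ++ [seq delta_mx 0 i | i <- enum 'I_N]), (Num.min 1 (e / 2)).
split; first by rewrite lt_min ltr01 divr_gt0.
move=> X p q pS qS qB pq b c.
have pB i : p (0, delta_mx 0 i) <= B + 1.
  have := pq (delta_mx 0 i) _ 0 1; rewrite mem_cat map_f ?mem_enum ?orbT //.
  rewrite scale1r ratr_row_delta normr1 mulr1 => /(_ isT).
  rewrite le_min ler_norml => /andP[/andP[_ h] _].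
  by have := qB i; lra.
have inr_S (r : X * 'rV[R]_N -> R) : seminorm r -> seminorm (fun c => r (0, c)).
  move=> [rZ rD]; split=> [a x|x y].
    by rewrite -rZ; congr r; congr (_, _); rewrite scaler0.
  by have := rD (0, x) (0, y); rewrite -[(0, x) + (0, y)]/(0 + 0, x + y) addr0.
have p1 c' : p (0, c') <= (B + 1) * l1 c' by apply: (seminorm_rV_le _ (inr_S _ pS)).
have q1 c' : q (0, c') <= B * l1 c' by apply: (seminorm_rV_le _ (inr_S _ qS)).
have lip (r : X * 'rV[R]_N -> R) c' : seminorm r ->
    `|r (b, c) - r (b, c')| <= r (0, c - c').
  move=> rS; rewrite (le_trans (seminorm_dist _ _ rS)) //.
  by rewrite -[(b, c) - (b, c')]/(b - b, c - c') subrr.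
have r0 : 0 <= l1 c by apply: seminorm_ge0; exact: l1_seminorm.
pose c' := (l1 c)^-1 *: c.
have cc' : c = l1 c *: c'.
  have [h|h] := eqVneq (l1 c) 0; first by rewrite h scale0r; exact: l1_eq0.
  by rewrite scalerA mulfV // scale1r.
have c'1 : l1 c' <= 1.
  rewrite (l1_seminorm R N).1 normfV ger0_norm // mulrC.
  by have [->|h] := eqVneq (l1 c) 0; rewrite ?mul0r // mulfV.
have [g gs cg] := hs c' c'1.
have dg : l1 (c - l1 c *: ratr_row g) <= l1 c * (e / (2 * M)).
  rewrite {1}cc' -scalerBr (l1_seminorm R N).1 ger0_norm // ler_wpM2l //.
have := pq g _ b (l1 c); rewrite mem_cat gs => /(_ isT).
rewrite (ger0_norm r0) => h.
have {}h : `|p (b, l1 c *: ratr_row g) - q (b, l1 c *: ratr_row g)| <= e / 2 * l1 c.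
  by apply: le_trans h _; rewrite ler_wpM2r // ge_min lexx orbT.
have hp := le_trans (lip p (l1 c *: ratr_row g) pS) (p1 _).
have hq := le_trans (lip q (l1 c *: ratr_row g) qS) (q1 _).
have hM : (B + 1 + B) * l1 (c - l1 c *: ratr_row g) <= e / 2 * l1 c.
  have -> : e / 2 * l1 c = M * (l1 c * (e / (2 * M))) by field; rewrite gt_eqF.
  rewrite (_ : B + 1 + B = M) ?ler_wpM2l ?(ltW M0) //; rewrite /M; ring.
move: h hp hq; rewrite !ler_norml => /andP[? ?] /andP[? ?] /andP[? ?].
by apply/andP; split; nra.
Qed.

Lemma seminorm_net_rV N (B e : R) : 0 <= B -> 0 < e ->
  exists (s : seq 'rV[rat]_N) (d : R), 0 < d /\
  forall p q : 'rV[R]_N -> R, seminorm p -> seminorm q ->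
    (forall i, q (delta_mx 0 i) <= B) ->
    (forall g, g \in s -> `|p (ratr_row g) - q (ratr_row g)| <= d) ->
  forall c, `|p c - q c| <= e * l1 c.
Proof.
move=> B0 e0; have [s [d [d0 h]]] := @seminorm_net N B e B0 e0.
exists s, d; split=> // p q pS qS qB pq c.
pose s2 : {linear (R^o * 'rV[R]_N)%type -> 'rV[R]_N} := snd.
apply: (h _ _ _ (seminorm_comp s2 pS) (seminorm_comp s2 qS) _ _ 0) => //= g gs _ t.
by rewrite pS.1 qS.1 -mulrBr normrM normr_id mulrC ler_wpM2r // pq.
Qed.

Lemma seminorm_rV_continuous N (p : 'rV[R]_N -> R) :
  seminorm p -> continuous p.
Proof.
move=> pS c; apply/(@cvgrPdist_lt _ _ _ (nbhs c) (nbhs_filter c)) => e e0.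
pose B := \sum_i p (delta_mx 0 i).
have B0 : 0 <= B by apply: sumr_ge0 => i _; exact: seminorm_ge0.
have pB c' : p c' <= B * N%:R * `|c'|.
  apply: le_trans (_ : B * l1 c' <= _).
    apply: seminorm_rV_le => // i; rewrite /B (bigD1 i) //= lerDl.
    by apply: sumr_ge0 => k _; exact: seminorm_ge0.
  rewrite -mulrA ler_wpM2l // /l1 mulr_natl -[X in _ *+ X]card_ord -sumr_const.
  apply: ler_sum => k _; rewrite [leRHS]/Num.norm /= mx_normrE.
  by apply/bigmax_geP; right => /=; exists (0, k).
have C0 : 0 < B * N%:R + 1 by rewrite ltr_wpDl // mulr_ge0.
near=> c'; rewrite (le_lt_trans (seminorm_dist _ _ pS)) //.
rewrite (le_lt_trans (pB _)) //.
apply: (@le_lt_trans _ _ ((B * N%:R + 1) * `|c - c'|)).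
  by rewrite ler_wpM2r // lerDl.
rewrite mulrC -ltr_pdivlMr //; near: c'.
by apply: cvgr_dist_lt; [exact: cvg_id|rewrite divr_gt0].
Unshelve. all: by end_near. Qed.

(** The continuous function |f c| has a positive minimum on the compact sphere
    of the vectors with l1 c = 1. *)
Lemma l1_le_norm N (X : normedModType R) (f : {linear 'rV[R]_N -> X}) :
  (forall c, f c = 0 -> c = 0) ->
  exists2 C : R, 0 < C & forall c, l1 c <= C * `|f c|.
Proof.
move=> finj; case: N f finj => [|N] f finj.
  exists 1 => // c; rewrite /l1 big_ord0 mul1r; exact: normr_ge0.
pose A := [set c : 'rV[R]_N.+1 | l1 c = 1].
have A0 : A !=set0 by exists (delta_mx 0 0); exact: l1_delta.
have fS : seminorm (fun c => `|f c|) := seminorm_comp f (seminorm_norm X).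
have Acl : closed A.
  rewrite (_ : A = (@l1 R N.+1) @^-1` [set 1]) //.
  apply: closed_comp => [c _|]; last exact: closed_eq.
  exact: seminorm_rV_continuous (l1_seminorm _ _) _.
have Abd : bounded_set A.
  exists 1; split; first exact: num_real.
  move=> M M1 c Ac; apply: le_trans (ltW M1).
  rewrite [leLHS]/Num.norm /= mx_normrE; apply/bigmax_leP; split=> // -[i k] _ /=.
  by rewrite (ord1 i) -Ac l1_coord.
have [|c cA cmin] :=
  EVT_min_rV A0 (bounded_closed_compact Abd Acl) (f := fun c => `|f c|).
  by apply: continuous_subspaceT; exact: seminorm_rV_continuous.
have c0 : 0 < `|f c|.
  rewrite normr_gt0; apply/eqP => /finj c0; move: cA; rewrite inE /A /= c0.
  by rewrite (seminorm0 (l1_seminorm _ _)) => /esym/eqP; rewrite oner_eq0.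
exists `|f c|^-1; first by rewrite invr_gt0.
move=> t; have [t0|t0] := eqVneq (l1 t) 0.
  by rewrite t0 mulr_ge0 // invr_ge0.
have t0' : 0 < l1 t by rewrite lt_def t0 seminorm_ge0 //; exact: l1_seminorm.
rewrite mulrC ler_pdivlMr // mulrC -ler_pdivlMr //.
have := cmin ((l1 t)^-1 *: t); rewrite inE /A /= (l1_seminorm _ _).1.
rewrite normfV gtr0_norm // mulVf // => /(_ erefl).
by rewrite fS.1 normfV gtr0_norm // mulrC.
Qed.

End FiniteDimension.

Lemma lc_dist (R : realType) (X : normedModType R) n (a b : 'I_n -> X) (t : R) c :
  (forall i, `|a i - b i| <= t) -> `|lc a c - lc b c| <= t * l1 c.
Proof.
move=> ab; rewrite /lc -sumrB; apply: le_trans (ler_norm_sum _ _ _) _.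
rewrite /l1 mulr_sumr ler_sum // => k _.
by rewrite -scalerBr normrZ mulrC ler_wpM2r.
Qed.

(** * Bases and finite-dimensional subspaces *)

Section Bases.
Variable R : realType.

Lemma linear_exists (U V : lmodType R) (h : U -> V) :
  linear h -> exists f : {linear U -> V}, f =1 h.
Proof.
move=> hl; pose f : {linear U -> V} := HB.pack h (GRing.isLinear.Build R U V *:%R h hl).
by exists f.
Qed.

Lemma linear_factor (V B F : lmodType R) (f : {linear V -> B}) (g : {linear V -> F}) :
  (forall b, exists v, b = f v) -> (forall v, f v = 0 -> g v = 0) ->
  exists j : {linear B -> F}, forall v, j (f v) = g v.
Proof.
move=> fsurj fg; pose s b := sval (cid (fsurj b)).
have fs b : f (s b) = b by rewrite -(svalP (cid (fsurj b))).
have gs v : g (s (f v)) = g v.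
  by apply/eqP; rewrite -subr_eq0 -linearB fg // linearB fs subrr.
have lin : linear (g \o s).
  move=> a x y /=; rewrite -linearP -[in LHS](fs x) -[in LHS](fs y) -linearP.
  exact: gs.
by have [j jE] := linear_exists lin; exists j => v; rewrite jE /= gs.
Qed.

Lemma isometry_factor (V : lmodType R) (B F : completeNormedModType R)
    (f : {linear V -> B}) (g : {linear V -> F}) :
  (forall b, exists v, b = f v) -> (forall v, `|g v| = `|f v|) ->
  exists j : embedding B F, forall v, j (f v) = g v.
Proof.
move=> fsurj fg; have [|j jE] := linear_factor (g := g) fsurj.
  by move=> v fv; apply/eqP; rewrite -normr_eq0 fg fv normr0.
have jN x : `|j x| = `|x| by have [v ->] := fsurj x; rewrite jE fg.
by exists (Embedding jN).
Qed.

Lemma lc_lift (V : lmodType R) k (v : 'I_k.+1 -> V) i (c : 'rV[R]_k.+1) :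
  c 0 i = 0 -> lc v c = lc (v \o lift i) (\row_l c 0 (lift i l)).
Proof.
move=> ci; rewrite /lc (bigD1_ord i) //= ci scale0r add0r.
by apply: eq_bigr => l _; rewrite mxE.
Qed.

(** A spanning family of minimal length is independent, here modulo the image of
    j and after applying F: a vector with nonzero coefficient in a relation is
    spanned by the others. *)
Lemma relative_basis (W X Y : lmodType R) (j : {linear W -> Y})
    (F : {linear X -> Y}) :
  (exists n (u : 'I_n -> X), forall x, exists w c, F x = j w + F (lc u c)) ->
  exists k (u : 'I_k -> X), (forall x, exists w c, F x = j w + F (lc u c)) /\
    (forall w c, j w + F (lc u c) = 0 -> c = 0).
Proof.
move=> [n0 [u0 hu0]].
pose P n := `[< exists u : 'I_n -> X, forall x, exists w c, F x = j w + F (lc u c) >].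
have exP : exists n, P n by exists n0; apply/asboolP; exists u0.
case: (ex_minnP exP) => k /asboolP[u hu] kmin; exists k, u; split=> // w c wc.
apply/eqP/negPn/negP => /rV0Pn[i ci].
case: k u hu kmin c wc i ci => [|k] u hu kmin c wc i ci; first by case: i ci.
suff /kmin : P k by rewrite ltnn.
apply/asboolP; exists (u \o lift i) => x; have [w' [d xE]] := hu x.
pose a := d 0 i / c 0 i.
exists (w' - a *: w), (\row_l (d - a *: c) 0 (lift i l)).
rewrite -lc_lift; last by rewrite !mxE /a divfK // subrr.
rewrite xE !linearB !linearZ /= addrACA -scalerDr -opprD.
by rewrite wc oppr0 scaler0 addr0.
Qed.

(** Finite-dimensional subspaces are closed.  A vector b outside the range could be
    added to a basis of it; by [l1_le_norm] the coefficient 1 of b would then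
    keep b - f c away from 0 for all c. *)
Lemma dense_range_surjective N (B : normedModType R) (f : {linear 'rV[R]_N -> B}) :
  (forall b (e : R), 0 < e -> exists c, `|b - f c| <= e) ->
  forall b, exists c, b = f c.
Proof.
move=> fdense b.
pose z : {linear 'rV[R]_N -> B} := \0.
have [|k [u [hu uindep]]] := @relative_basis _ _ _ z f.
  exists N, (fun i => delta_mx 0 i) => x; exists 0, x.
  by rewrite add0r /lc -row_sum_delta.
have [//|bN] := pselect (exists c, b = f c).
pose g (c : 'rV[R]_(1 + k)) := lc (fun=> b) (lsubmx c) + f (lc u (rsubmx c)).
have glin : linear g.
  by move=> a x y; rewrite /g !linearP /= scalerDr addrACA.
have [g' gE] := linear_exists glin.
have ginj c : g' c = 0 -> c = 0.
  rewrite gE /g /lc big_ord1 => h.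
  have [c0|c0] := eqVneq (lsubmx c 0 0) 0; last first.
    case: bN; exists (- (lsubmx c 0 0)^-1 *: lc u (rsubmx c)).
    rewrite linearZ /= -(addKr (lsubmx c 0 0 *: b) (f _)) h addr0.
    by rewrite scalerN scaleNr opprK scalerA mulVf // scale1r.
  have c1 : rsubmx c = 0 by apply: (uindep 0); rewrite add0r -h c0 scale0r add0r.
  rewrite -[c]hsubmxK c1; have -> : lsubmx c = 0.
    by apply/rowP => i; rewrite (ord1 i) c0 mxE.
  exact: row_mx0.
have [C C0 hC] := l1_le_norm ginj.
have [|c hc] := fdense b (2 * C)^-1; first by rewrite invr_gt0 mulr_gt0.
have [x [d cd]] := hu c; have {}cd : f c = f (lc u d) by rewrite cd add0r.
pose m : 'rV[R]_(1 + k) := row_mx (const_mx 1) (- d).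
have m1 : 1 <= l1 m.
  by have := l1_coord m (lshift k ord0); rewrite row_mxEl mxE normr1.
have := hC m; rewrite gE /g row_mxKl row_mxKr /lc big_ord1 mxE scale1r -/(lc u (- d)).
rewrite !linearN -cd => h.
have : 1 <= C * (2 * C)^-1.
  by apply: le_trans m1 (le_trans h _); rewrite ler_wpM2l // ltW.
by rewrite invfM mulrCA mulfV ?gt_eqF // mulr1; lra.
Qed.

End Bases.

(** * Amalgamation of semi-norms *)

Section Amalgams.
Variable R : realType.

(** The extension of eta is
      zeta v = inf_c eta (f v - y) + xi (v - T (f v) + T y) + e * l1 c
    where y = lc w c ranges over the span of the vectors w i = f (L_i).  The
    last term pays for the difference between eta and the restriction of xi on
    this span, which [seminorm_net_rV] makes at most e * l1 c; hence the
    decomposition y = 0 is optimal on the image of T.  For v = L_i the choice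
    y = w i gives zeta v <= xi v + e; conversely eta (f v - y) may be replaced
    by xi (T (f v - y)), at the cost of e * l1 c + e, and then the triangle
    inequality of xi applies. *)
Lemma open_restriction (V W : lmodType R) (T : {linear W -> V})
    (f : {linear V -> W}) (xi : V -> R) (L : seq V) (e : R) :
    cancel T f -> seminorm xi -> 0 < e ->
  exists (L' : seq W) (d : R), 0 < d /\ forall eta : W -> R, seminorm eta ->
    (forall w, w \in L' -> `|eta w - xi (T w)| < d) ->
  exists zeta : V -> R, [/\ seminorm zeta, forall w, zeta (T w) = eta w &
    forall v, v \in L -> `|zeta v - xi v| <= e].
Proof.
move=> Tf xiS e0; pose w (i : 'I_(size L)) := f (tnth (in_tuple L) i).
pose B := \sum_i xi (T (w i)).
have B0 : 0 <= B by apply: sumr_ge0 => i _; exact: seminorm_ge0.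
have [s [d [d0 hs]]] := @seminorm_net_rV R (size L) B e B0 e0.
exists [seq lc w (ratr_row R g) | g <- s], d; split=> // eta etaS hL.
have {hs hL}close c : `|eta (lc w c) - xi (T (lc w c))| <= e * l1 c.
  pose Tw : {linear 'rV[R]_(size L) -> V} := T \o lc w.
  apply: (hs _ _ (seminorm_comp (lc w) etaS) (seminorm_comp Tw xiS)).
    move=> i; rewrite /= lc_delta /B (bigD1 i) //= lerDl.
    by apply: sumr_ge0 => k _; exact: seminorm_ge0.
  by move=> g gs; apply/ltW/(hL (lc w (ratr_row R g))); apply/mapP; exists g.
pose K := 'rV[R]_(size L).
pose A1 : {linear (V * K)%type -> W} := (f \o fst) \- (lc w \o snd).
pose A2 : {linear (V * K)%type -> V} :=
  (fst \- (T \o (f \o fst))) \+ (T \o (lc w \o snd)).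
pose P := ((eta \o A1) \+ (xi \o A2)) \+ (fun vc => e * (@l1 R (size L) \o snd) vc).
have PS : seminorm P.
  apply: seminormD; first by apply: seminormD; exact: seminorm_comp.
  apply: (@seminormM _ _ (@l1 R (size L) \o snd)); first exact: ltW.
  by apply: seminorm_comp; exact: l1_seminorm.
have PE v c : P (v, c) =
    eta (f v - lc w c) + xi (v - T (f v) + T (lc w c)) + e * l1 c by [].
exists (inf_snd P); split; first exact: inf_snd_seminorm.
- move=> x; apply/le_anti/andP; split.
    apply: le_trans (inf_snd_le PS _ 0) _.
    rewrite PE Tf (linear0 (lc w)) (linear0 T) subr0 subrr addr0.
    by rewrite (seminorm0 xiS) (seminorm0 (l1_seminorm _ _)) mulr0 !addr0.
  apply: (inf_snd_ge PS) => c; rewrite PE Tf subrr add0r.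
  have := etaS.2 (x - lc w c) (lc w c); rewrite subrK.
  by have := close c; rewrite ler_norml => /andP[? ?]; lra.
- move=> v vL; have /tuple.tnthP[i vE] : v \in in_tuple L by [].
  have wi : f v = lc w (delta_mx 0 i) by rewrite lc_delta /w -vE.
  rewrite ler_norml; apply/andP; split.
    rewrite lerBrDr; apply: (inf_snd_ge PS) => c; rewrite PE.
    have := close (delta_mx 0 i - c); rewrite linearB /= -wi ler_norml => /andP[h _].
    have h1 : l1 (delta_mx 0 i - c) <= 1 + l1 c.
      rewrite -(l1_delta R i) (le_trans ((l1_seminorm _ _).2 _ _)) //.
      by rewrite (seminormN _ (l1_seminorm _ _)).
    have h2 := xiS.2 (v - T (f v) + T (lc w c)) (T (f v - lc w c)).
    rewrite linearB -addrA [T (lc w c) + _]addrC !subrK in h2.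
    by rewrite linearB in h; nra.
  rewrite lerBlDr; apply: le_trans (inf_snd_le PS _ (delta_mx 0 i)) _.
  by rewrite PE -wi subrr subrK seminorm0 // l1_delta mulr1 add0r addrC.
Qed.

(** Gluing q to p along d, where d is an isometry only up to t:
      N (v, s) = inf_c p (v - lc d c) + q (c, s) + t * l1 c.
    The hypothesis makes the decomposition c = 0 optimal when s = 0. *)
Lemma extension_amalgam (V : lmodType R) m k (p : V -> R) (d : 'I_m -> V)
    (q : 'rV[R]_m * 'rV[R]_k -> R) (t : R) :
    seminorm p -> seminorm q -> 0 <= t ->
    (forall c, `|p (lc d c) - q (c, 0)| <= t * l1 c) ->
  exists N : V * 'rV[R]_k -> R, [/\ seminorm N, forall v, N (v, 0) = p v &
    forall c s, `|N (lc d c, s) - q (c, s)| <= t * l1 c].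
Proof.
move=> pS qS t0 close; pose X := (V * 'rV[R]_k)%type; pose K := 'rV[R]_m.
pose A1 : {linear (X * K)%type -> V} := (fst \o fst) \- (lc d \o snd).
have [A2 A2E] : exists g : {linear (X * K)%type -> (K * 'rV[R]_k)%type},
    g =1 (fun x => (x.2, x.1.2)).
  by apply: linear_exists.
pose A3 : {linear (X * K)%type -> K} := snd.
pose P := ((p \o A1) \+ (q \o A2)) \+ (fun xk => t * (@l1 R m \o A3) xk).
have l1S := l1_seminorm R m.
have PS : seminorm P.
  apply: seminormD; first by apply: seminormD; exact: seminorm_comp.
  by apply: (@seminormM _ _ (@l1 R m \o A3)) => //; exact: seminorm_comp.
have PE v s c : P ((v, s), c) = p (v - lc d c) + q (c, s) + t * l1 c.
  by rewrite /P /= A2E.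
exists (inf_snd P); split; first exact: inf_snd_seminorm.
- move=> v; apply/le_anti/andP; split.
    apply: le_trans (inf_snd_le PS _ 0) _; rewrite PE (linear0 (lc d)) subr0.
    by rewrite [q _](seminorm0 qS) (seminorm0 l1S) mulr0 !addr0.
  apply: (inf_snd_ge PS) => c; rewrite PE.
  have := pS.2 (v - lc d c) (lc d c); rewrite subrK.
  by have := close c; rewrite ler_norml => /andP[? ?]; lra.
- move=> c s; rewrite ler_norml; apply/andP; split.
    rewrite lerBrDr; apply: (inf_snd_ge PS) => c'; rewrite PE -linearB.
    have := close (c - c'); rewrite ler_norml => /andP[h _].
    have h1 : l1 (c - c') <= l1 c + l1 c'.
      by rewrite -(seminormN c' l1S); exact: l1S.2.
    have := qS.2 (c - c', 0) (c', s).
    rewrite -[(c - c', 0) + _]/(c - c' + c', 0 + s) subrK add0r => h2.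
    by nra.
  rewrite lerBlDr; apply: le_trans (inf_snd_le PS _ c) _.
  by rewrite PE subrr (seminorm0 pS) add0r addrC.
Qed.

(** The largest semi-norm that extends xi in the first variable and zeta in the
    second one, and makes the difference of the two k-th unit vectors of size
    at most r.  A decomposition (b', m') moves b' and m' from the copy of xi to
    the copy of zeta, at the price r * l1 m'. *)
Lemma metric_amalgam (W : lmodType R) n (xi zeta : W * 'rV[R]_n -> R) (r : R) :
    seminorm xi -> seminorm zeta -> 0 <= r ->
    (forall b l, `|xi (b, l) - zeta (b, l)| <= r * l1 l) ->
  exists N : (W * 'rV[R]_n) * 'rV[R]_n -> R,
    [/\ seminorm N, forall b l, N ((b, l), 0) = xi (b, l),
        forall b l, N ((b, 0), l) = zeta (b, l) &
        forall l, N ((0, l), - l) <= r * l1 l].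
Proof.
move=> xiS zetaS r0 close; pose K := (W * 'rV[R]_n)%type.
pose X := (K * 'rV[R]_n)%type.
pose A1 : {linear (X * K)%type -> K} := (fst \o fst) \- snd.
pose a2 (x : X * K) : K := (x.2.1, x.1.2 + x.2.2).
have a2l : linear a2.
  move=> a [[x1 x2] [x3 x4]] [[y1 y2] [y3 y4]]; congr (_, _).
  by rewrite /= scalerDr addrACA.
have [A2 A2E] := linear_exists a2l.
pose A3 : {linear (X * K)%type -> 'rV[R]_n} := snd \o snd.
pose P := ((xi \o A1) \+ (zeta \o A2)) \+ (fun xk => r * (@l1 R n \o A3) xk).
have PS : seminorm P.
  apply: seminormD; first by apply: seminormD; exact: seminorm_comp.
  apply: (@seminormM _ _ (@l1 R n \o A3)) => //.
  by apply: seminorm_comp; exact: l1_seminorm.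
have PE b l m k : P (((b, l), m), k) =
    xi ((b, l) - k) + zeta (k.1, m + k.2) + r * l1 k.2 by rewrite /P /= A2E.
exists (inf_snd P); split; first exact: inf_snd_seminorm.
- move=> b l; apply/le_anti/andP; split.
    apply: le_trans (inf_snd_le PS _ (0, 0)) _.
    rewrite PE -[X in xi X]/(b - 0, l - 0) /= !subr0 !addr0.
    by rewrite [zeta _](seminorm0 zetaS) (seminorm0 (l1_seminorm _ _)) mulr0 !addr0.
  apply: (inf_snd_ge PS) => -[k1 k2]; rewrite PE /= add0r.
  have := xiS.2 ((b, l) - (k1, k2)) (k1, k2); rewrite subrK.
  by have := close k1 k2; rewrite ler_norml => /andP[? ?]; lra.
- move=> b l; apply/le_anti/andP; split.
    apply: le_trans (inf_snd_le PS _ (b, 0)) _; rewrite PE /= subrr addr0.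
    by rewrite (seminorm0 xiS) (seminorm0 (l1_seminorm _ _)) mulr0 addr0 add0r.
  apply: (inf_snd_ge PS) => -[k1 k2]; rewrite PE /=.
  rewrite -[(b, 0) - _]/(b - k1, 0 - k2) add0r.
  have := close (b - k1) (- k2); rewrite (seminormN _ (l1_seminorm _ _)).
  have := zetaS.2 (b - k1, - k2) (k1, l + k2).
  rewrite -[(b - k1, - k2) + _]/(b - k1 + k1, - k2 + (l + k2)) subrK addrCA addNr addr0.
  by rewrite ler_norml => ? /andP[? ?]; lra.
- move=> l; apply: le_trans (inf_snd_le PS _ (0, l)) _; rewrite PE /= subrr addNr.
  by rewrite (seminorm0 xiS) [zeta _](seminorm0 zetaS) !add0r.
Qed.

End Amalgams.

(** * Topology and distance on the space of types *)

Definition close_on (R : realType) (V : lmodType R) (L : seq V) (d : R)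
    (p q : V -> R) : Prop :=
  forall v, v \in L -> `|p v - q v| < d.

Section TypeSpace.
Variable R : realType.
Implicit Types E F : completeNormedModType R.

Lemma ntype_eq E n (xi zeta : ntype E n) : (forall v, xi v = zeta v) -> xi = zeta.
Proof.
case: xi zeta => [f fS fE] [g gS gE] /= fg.
have {}fg : f = g by apply/funext.
by subst g; congr NType; exact: Prop_irrelevance.
Qed.

(** Convergence in the supremum of initial topologies is convergence in each of
    them, that is, pointwise convergence of semi-norms. *)
Lemma ntype_cvg E n (F : set_system (ntype E n)) (xi : ntype E n) : Filter F ->
  F --> xi <-> forall v (d : R), 0 < d -> F [set zeta | `|zeta v - xi v| < d].
Proof.
move=> FF.
pose Tc v := Topological.on (initial_topology (fun xi : ntype E n => xi v : R)).
have cs := @cvg_sup (ntype E n) (free_ext E n) Tc F xi FF.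
split=> [Fxi v d d0|h].
  have /cs/(_ v) Fv : F --> (xi : sup_topology Tc) by exact: Fxi.
  have c := @initial_continuous (ntype E n) R (fun x : ntype E n => x v : R) xi.
  have := Fv _ (c _ (nbhsx_ballx (xi v : R) d d0)).
  by apply: filterS => zeta; rewrite -ball_normE /= distrC.
apply/cs => v U /=; rewrite (@nbhsE (Topological.Pack (Tc v))).
move=> [_ [[A Aop <-] Axi] AU].
rewrite openE in Aop; have /nbhs_ballP[d /= d0 dA] := Aop _ Axi.
rewrite nbhs_filterE; apply: filterS (h v d d0) => zeta /= zd; apply: AU; apply: dA.
by rewrite -ball_normE /= distrC.
Qed.

Lemma ntype_nbhsP E n (xi : ntype E n) (U : set (ntype E n)) : nbhs xi U <->
  exists (L : seq (free_ext E n)) (d : R), 0 < d /\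
    forall zeta : ntype E n, close_on L d zeta xi -> U zeta.
Proof.
split=> [xiU|[L [d [d0 LU]]]].
  pose F : set_system (ntype E n) := [set U | exists (L : seq (free_ext E n)) (d : R),
    0 < d /\ forall zeta : ntype E n, close_on L d zeta xi -> U zeta].
  have FF : Filter F.
    split=> [|A B [L [d [d0 LA]]] [M [e [e0 MB]]]|A B AB [L [d [d0 LA]]]].
    - by exists [::], 1.
    - exists (L ++ M), (Num.min d e); split; first by rewrite lt_min d0.
      move=> zeta h; split; [apply: LA|apply: MB] => v vL.
        by have := h v; rewrite mem_cat vL lt_min => /(_ isT)/andP[].
      by have := h v; rewrite mem_cat vL orbT lt_min => /(_ isT)/andP[].
    - by exists L, d; split=> // zeta /LA/AB.
  suff : F --> xi by exact.
  apply/ntype_cvg => v d d0; exists [:: v], d; split=> // zeta; apply.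
  exact: mem_head.
have h : nbhs xi [set zeta : ntype E n | close_on L d zeta xi].
  have : nbhs xi --> xi by [].
  move/ntype_cvg => h; elim: L {LU} => [|v L IH]; first exact: filterS filterT.
  apply: filterS (filterI (h v d d0) IH) => zeta [vd Ld] w.
  by rewrite inE => /orP[/eqP ->|/Ld].
exact: filterS h.
Qed.

(** Isolation without reference to realisations of the types; see
    [isolated_typeE]. *)
Definition norm_isolated E n (xi : ntype E n) : Prop :=
  forall e : R, 0 < e -> exists (L : seq (free_ext E n)) (d : R), 0 < d /\
    forall zeta : ntype E n, close_on L d zeta xi ->
    forall b l, `|zeta (b, l) - xi (b, l)| <= e * l1 l.

Lemma ntype_dist_lt E n (xi zeta : ntype E n) (e : R) :
  (ntype_dist xi zeta < e%:E)%E ->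
  forall b l, `|zeta (b, l) - xi (b, l)| <= e * l1 l.
Proof.
move=> /ereal_inf_lt[_ [F [i [a [a' [-> -> ->]]]]]].
rewrite lte_fin => re b l; rewrite /= /tp_norm /=.
apply: le_trans (ler_dist_dist _ _) _.
rewrite opprD addrACA subrr add0r; apply: (@lc_dist _ _ _ a' a) => k.
rewrite distrC; apply: le_trans (ltW re).
by apply/bigmax_geP; right; exists k.
Qed.

(** Both types are realised in the completion of their amalgam, by the two
    copies of the unit vectors. *)
Lemma ntype_dist_le E n (xi zeta : ntype E n) (r : R) : 0 <= r ->
  (forall b l, `|xi (b, l) - zeta (b, l)| <= r * l1 l) ->
  (ntype_dist xi zeta <= r%:E)%E.
Proof.
move=> r0 close.
have [N [NS Nxi Nzeta Nr]] :=
  metric_amalgam (ntype_seminorm xi) (ntype_seminorm zeta) r0 close.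
have [B [f [fN _]]] := completion_exists NS.
pose K := ((E * 'rV[R]_n) * 'rV[R]_n)%type.
have [i0 i0E] : exists g : {linear E -> B}, g =1 (fun b => f (((b, 0), 0) : K)).
  by apply: linear_exists => a x y; rewrite -linearP;
  congr (f (_, _, _)); rewrite /= ?scaler0 ?addr0.
have iN x : `|i0 x| = `|x| by rewrite i0E fN Nxi ntype_extends.
pose a k := f (((0, delta_mx 0 k), 0) : K); pose a' k := f (((0, 0), delta_mx 0 k) : K).
have sumE b (l m : 'rV[R]_n) : f (((b, l), m) : K) = i0 b + lc a l + lc a' m.
  have [ga gaE] : exists g : {linear 'rV[R]_n -> B},
      g =1 (fun l => f (((0, l), 0) : K)).
    by apply: linear_exists => c x y; rewrite -linearP;
  congr (f (_, _, _)); rewrite /= ?scaler0 ?addr0.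
  have [ga' ga'E] : exists g : {linear 'rV[R]_n -> B},
      g =1 (fun l => f (((0, 0), l) : K)).
    by apply: linear_exists => c x y; rewrite -linearP;
  congr (f (_, _, _)); rewrite /= ?scaler0 ?addr0.
  have -> : lc a l = ga l.
    rewrite [in RHS](row_sum_delta l) linear_sum; apply: eq_bigr => k _.
    by rewrite linearZ /= gaE.
  have -> : lc a' m = ga' m.
    rewrite [in RHS](row_sum_delta m) linear_sum; apply: eq_bigr => k _.
    by rewrite linearZ /= ga'E.
  by rewrite gaE ga'E i0E -!linearD; congr (f (_, _, _)); rewrite /= ?addr0 ?add0r.
apply: (@le_trans _ _ ((\big[Num.max/0]_(k < n) `|a k - a' k|)%:E)).
  apply: ereal_inf_lbound; exists B, (Embedding iN), a, a'; split=> //.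
    apply: ntype_eq => -[b l]; rewrite /= /tp_norm /= -/(lc a l).
    by rewrite -Nxi -fN sumE (linear0 (lc a')) addr0.
  apply: ntype_eq => -[b l]; rewrite /= /tp_norm /= -/(lc a' l).
  by rewrite -Nzeta -fN sumE (linear0 (lc a)) addr0.
rewrite lee_fin; apply/bigmax_leP; split=> // k _.
have -> : a k - a' k = f (((0, delta_mx 0 k), - delta_mx 0 k) : K).
  by rewrite sumE (linear0 i0) add0r (linearN (lc a')) /= !lc_delta.
by rewrite fN (le_trans (Nr _)) // l1_delta mulr1.
Qed.

Lemma isolated_typeE E n (xi : ntype E n) : isolated_type xi <-> norm_isolated xi.
Proof.
split=> [h e e0|h U [e e0 eU]].
  have /h/ntype_nbhsP[L [d [d0 Ld]]] :
      metric_nbhs xi [set zeta | (ntype_dist xi zeta < e%:E)%E] by exists e.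
  by exists L, d; split=> // zeta /Ld; exact: ntype_dist_lt.
have [|L [d [d0 Ld]]] := h (e / 2); first by rewrite divr_gt0.
apply/ntype_nbhsP; exists L, d; split=> // zeta /Ld close; apply: eU.
apply: (@le_lt_trans _ _ (e / 2)%:E).
  by apply: ntype_dist_le => [|b l]; [rewrite divr_ge0 // ltW|rewrite distrC].
by rewrite lte_fin; lra.
Qed.

Lemma dense_isolatedP E n :
  dense [set xi : ntype E n | isolated_type xi] <->
  forall (xi : ntype E n) L (d : R), 0 < d ->
    exists2 zeta : ntype E n, norm_isolated zeta & close_on L d zeta xi.
Proof.
split=> [h xi L d d0|h U [xi Uxi] Uop].
  have xin : nbhs xi [set zeta : ntype E n | close_on L d zeta xi].
    by apply/ntype_nbhsP; exists L, d.
  have [||zeta [/interior_subset zd /= /isolated_typeE zi]] :=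
    h [set zeta : ntype E n | close_on L d zeta xi]^°; last by exists zeta.
  - by exists xi.
  - exact: open_interior.
have /ntype_nbhsP[L [d [d0 Ld]]] : nbhs xi U by exact: open_nbhs_nbhs.
have [zeta zi zd] := h xi L d d0; exists zeta; split; first exact: Ld.
exact/isolated_typeE.
Qed.

End TypeSpace.

(** * A Baire category argument for extensions of the norm *)

Section Baire.
Variables (R : realType) (E : completeNormedModType R).

Local Notation V := (E * {poly R})%type.

Definition extends_norm (p : V -> R) : Prop :=
  seminorm p /\ forall b, p (b, 0) = `|b|.

(** A sequence of extensions of the norm that is bounded at each monomial is
    thus bounded at each vector, which makes pointwise limits exist. *)
Lemma extends_norm_le p (b : E) (q : {poly R}) n : extends_norm p ->
  (size q <= n)%N -> p (b, q) <= `|b| + \sum_(i < n) `|q`_i| * p (0, 'X^i).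
Proof.
move=> [pS pE] qn.
have h2 : p (0, q) <= \sum_(i < n) `|q`_i| * p (0, 'X^i).
  have -> : (0, q) = \sum_(i < n) q`_i *: ((0, 'X^i) : V).
    have [g gE] : exists g : {linear {poly R} -> V}, g =1 (fun q => (0, q)).
      by apply: linear_exists => a x y; congr (_, _); rewrite /= scaler0 addr0.
    rewrite -gE -[in LHS](take_poly_id qn) /take_poly poly_def.
    by rewrite linear_sum; apply: eq_bigr => i _; rewrite linearZ /= gE.
  apply: le_trans (seminorm_sum _ _ pS) _.
  by apply: ler_sum => i _; rewrite pS.1.
have := pS.2 (b, 0) (0, q); rewrite pE -[(b, 0) + (0, q)]/(b + 0, 0 + q) addr0 add0r.
by move=> h1; apply: le_trans h1 _; rewrite lerD2l.
Qed.

(** A stage is a closed basic neighbourhood of a semi-norm; the Baire argument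
    builds a decreasing sequence of them. *)
Record stage := Stage {
  stage_norm : V -> R;
  stage_list : seq V;
  stage_radius : R;
  stage_extends : extends_norm stage_norm;
  stage_radius_gt0 : 0 < stage_radius }.

Definition in_stage (s : stage) (p : V -> R) : Prop :=
  extends_norm p /\
  forall v, v \in stage_list s -> `|p v - stage_norm s v| <= stage_radius s.

Lemma in_stage_self s : in_stage s (stage_norm s).
Proof.
split=> [|v _]; first exact: stage_extends.
by rewrite subrr normr0 ltW // stage_radius_gt0.
Qed.

Definition open_condition (O : (V -> R) -> Prop) : Prop :=
  forall p, extends_norm p -> O p -> exists L (d : R), 0 < d /\
    forall q, extends_norm q -> close_on L d q p -> O q.

Definition adherent (O : (V -> R) -> Prop) (p : V -> R) : Prop :=
  forall L (d : R), 0 < d ->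
    exists q, [/\ extends_norm q, close_on L d q p & O q].

(** If the open set O meets the interior of the stage s, then s' is chosen
    inside O; otherwise s' only shrinks s.  The vector x is put in the list so
    that values at x stay bounded along the sequence of stages. *)
Lemma refine_stage (O : (V -> R) -> Prop) (x : V) (s : stage) : open_condition O ->
  exists s' : stage, [/\ x \in stage_list s', stage_radius s' <= 1,
    forall p, in_stage s' p ->
      in_stage s p /\ close_on (stage_list s) (stage_radius s) p (stage_norm s) &
    (exists q, [/\ extends_norm q,
       close_on (stage_list s) (stage_radius s) q (stage_norm s) & O q]) ->
    forall p, in_stage s' p -> O p].
Proof.
case: s => n L d nE d0 Oop /=.
have [m [mE mn mO]] : exists m, [/\ extends_norm m, close_on L d m n &
    (exists q, [/\ extends_norm q, close_on L d q n & O q]) -> O m].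
  have [[q [qE qn Oq]]|no] :=
    pselect (exists q, [/\ extends_norm q, close_on L d q n & O q]).
    by exists q.
  by exists n; split=> // v _; rewrite subrr normr0.
have [M [c [c0 hM]]] : exists M (c : R), 0 < c /\
    (O m -> forall q, extends_norm q -> close_on M c q m -> O q).
  have [Om|nOm] := pselect (O m); last by exists [::], 1.
  by have [M [c [c0 hM]]] := Oop m mE Om; exists M, c.
have [r [r0 hr]] := margin mn.
pose e := Num.min 1 (Num.min c r) / 2.
have e0 : 0 < e by rewrite divr_gt0 // !lt_min ltr01 c0 r0.
have [e1 ec er] : [/\ e <= 1, e < c & e < r].
  have hm : 0 < Num.min 1 (Num.min c r) by rewrite !lt_min ltr01 c0 r0.
  have : e < Num.min 1 (Num.min c r) by rewrite /e; lra.
  by rewrite !lt_min => /and3P[/ltW].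
exists (@Stage m (x :: L ++ M) e mE e0); split=> //= [|p [pE pm]|hq p [pE pm]].
- exact: mem_head.
- suff cl : close_on L d p n by split=> //; split=> // v vL; exact/ltW/cl.
  move=> v vL; apply: lt_le_trans (hr v vL).
  have := pm v; rewrite inE mem_cat vL orbT => /(_ isT) pmv.
  rewrite (le_lt_trans (ler_distD (m v) _ _)) // addrC ltrD2l.
  exact: le_lt_trans pmv er.
- apply: (hM (mO hq)) => // v vM; apply: le_lt_trans ec; apply: pm.
  by rewrite inE mem_cat vM !orbT.
Qed.

Lemma ultrafilter_bounded_cvg (F : set_system nat) (u : nat -> R) (C : R) :
  UltraFilter F -> F [set k | `|u k| <= C] -> exists l : R, u @ F --> l.
Proof.
move=> FU uC; have FF : ProperFilter F by exact: ultra_proper.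
have uI : (u @ F) `[- C, C]%classic.
  by apply: (@filterS _ F _ _ _ _ uC) => k; rewrite /= in_itv /= ler_norml.
have [l [_ lc]] := @segment_compact R (- C) C (u @ F) _ uI.
exists l; apply/cvgrPdist_lt => e e0.
have [//|nF] := @in_ultra_setVsetC _ F [set k | `|l - u k| < e] FU.
have [||_ [[k kF <-] kl]] := lc [set u k | k in ~` [set k | `|l - u k| < e]] (ball l e).
- by apply: (@filterS _ F _ _ _ _ nF) => k hk; exists k.
- exact: nbhsx_ballx.
by move: kl; rewrite -ball_normE.
Qed.

(** The stage k.+1 lies in O k unless the interior of the stage k is disjoint
    from O k.  The centres of the stages converge pointwise along an
    ultrafilter, their values being bounded by [extends_norm_le]; the limit p
    lies in the interior of all stages, so it cannot be adherent to O k in the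
    second case. *)
Lemma generic_norm (p0 : V -> R) (O : nat -> (V -> R) -> Prop) : extends_norm p0 ->
  (forall k, open_condition (O k)) ->
  exists p, extends_norm p /\ forall k, adherent (O k) p -> O k p.
Proof.
move=> p0E Oop.
pose next k s := sval (cid (refine_stage (0, 'X^k) s (Oop k))).
pose fix S k := if k is k'.+1 then next k' (S k') else @Stage p0 [::] 1 p0E ltr01.
have SP k := svalP (cid (refine_stage (0, 'X^k) (S k) (Oop k))).
have desc l k p : (k <= l)%N -> in_stage (S l) p -> in_stage (S k) p.
  elim: l => [|l IH]; first by rewrite leqn0 => /eqP ->.
  rewrite leq_eqVlt => /orP[/eqP -> //|]; rewrite ltnS => kl h.
  by apply: IH => //; have [_ _ /(_ p h)[]] := SP l.
pose u l := stage_norm (S l).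
have uE l : extends_norm (u l) := stage_extends (S l).
have uS l k : (k <= l)%N -> in_stage (S k) (u l).
  by move=> kl; apply: desc kl _; exact: in_stage_self.
have [F [FU Foo]] := ultraFilterLemma (@eventually_filter).
have FF : ProperFilter F by exact: ultra_proper.
have Fge k : F [set l | (k <= l)%N] by apply: Foo; exists k.
have ucvg v : exists l : R, u^~ v @ F --> l.
  case: v => b q.
  pose C := `|b| + \sum_(i < size q) `|q`_i| * (u i.+1 (0, 'X^i) + 1).
  apply: (@ultrafilter_bounded_cvg _ _ C) => //.
  apply: filterS (Fge (size q)) => l /= ql.
  rewrite ger0_norm; last exact: seminorm_ge0 (uE l).1.
  apply: le_trans (extends_norm_le b (uE l) (leqnn _)) _; rewrite lerD2l.
  apply: ler_sum => i _; rewrite ler_wpM2l //.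
  have [xi r1 _ _] := SP i.
  have [_ /(_ _ xi)] := uS l i.+1 (leq_trans (ltn_ord i) ql).
  by move/le_trans => /(_ _ r1); exact: ler_distlDr.
pose p v := sval (cid (ucvg v)).
have pv v : u^~ v @ F --> p v := svalP (cid (ucvg v)).
have pE : extends_norm p.
  split; [split=> [a x|x y]|move=> b].
  - apply: (cvg_unique _ (pv (a *: x))) => //.
    have -> : u^~ (a *: x) = (fun l => `|a| * u l x).
      by apply/funext => l; exact: (uE l).1.1.
    by apply: cvgM; [exact: cvg_cst|exact: pv].
  - apply: (ler_cvg_to (pv (x + y)) (cvgD (pv x) (pv y))).
    by apply: nearW => l; exact: (uE l).1.2.
  - apply: (cvg_unique _ (pv (b, 0))) => //.
    have -> : u^~ (b, 0) = (fun=> `|b|) by apply/funext => l; exact: (uE l).2.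
    exact: cvg_cst.
have pin k : in_stage (S k) p.
  split=> // v vk.
  have h : (fun l => `|u l v - stage_norm (S k) v|) @ F --> `|p v - stage_norm (S k) v|.
    by apply: cvg_norm; apply: cvgB; [exact: pv|exact: cvg_cst].
  apply: (cvgr_to_le h); apply: filterS (Fge k) => l /= kl.
  by have [_ /(_ v vk)] := uS l k kl.
exists p; split=> // k adh; have [_ _ pcl pO] := SP k.
apply: pO; last exact: pin k.+1.
have [_ cl] := pcl p (pin k.+1).
have [r [r0 hr]] := margin cl.
have [q [qE qp Oq]] := adh (stage_list (S k)) r r0.
exists q; split=> // v vL; apply: lt_le_trans (hr v vL).
rewrite (le_lt_trans (ler_distD (p v) _ _)) // addrC ltrD2l.
exact: qp.
Qed.

End Baire.

(** * Types realised in a Gurarij space *)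

Lemma finite_dimensional_surj (R : realType) N (V : lmodType R)
    (f : {linear 'rV[R]_N -> V}) :
  (forall x, exists c, x = f c) -> finite_dimensional V.
Proof.
move=> fs; exists N, (fun i => f (delta_mx 0 i)) => x; have [c ->] := fs x.
exists (c 0); rewrite [in LHS](row_sum_delta c) linear_sum.
by apply: eq_bigr => i _; rewrite linearZ.
Qed.

Section IsolatedTypes.
Variable R : realType.
Implicit Types E F G : completeNormedModType R.

(** E0 is a copy of the span in E of the first components of the vectors of L,
    and F is the extension of it by n vectors that xi describes.  The Gurarij
    property maps F to G over E0, changing the norms by a factor close to 1;
    the images of the n new vectors realise a type that is close to xi on L. *)
Lemma gurarij_types_dense E G (i : embedding E G) n (xi : ntype E n) L (d : R) :
  gurarij G -> 0 < d -> exists a : 'I_n -> G, close_on L d (tp i a) xi.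
Proof.
move=> gG d0; pose m := size L.
pose b (t : 'I_m) : E := (tnth (in_tuple L) t).1.
have [h hE] : exists h : {linear 'rV[R]_(m + n) -> free_ext E n},
    h =1 (fun c => (lc b (lsubmx c), rsubmx c)).
  by apply: linear_exists => x u v; congr (_, _); rewrite !linearP.
have [F [f2 [f2N f2d]]] := completion_exists (seminorm_comp h (ntype_seminorm xi)).
have [E0 [f1 [f1N f1d]]] := completion_exists (seminorm_comp (lc b) (seminorm_norm E)).
have f2s := dense_range_surjective f2d; have f1s := dense_range_surjective f1d.
have [inl inlE] : exists g : {linear 'rV[R]_m -> 'rV[R]_(m + n)},
    g =1 (fun c => row_mx c 0).
  by apply: linear_exists => x u v; rewrite scale_row_mx add_row_mx scaler0 addr0.
have [inr inrE] : exists g : {linear 'rV[R]_n -> 'rV[R]_(m + n)},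
    g =1 row_mx 0.
  by apply: linear_exists => x u v; rewrite scale_row_mx add_row_mx scaler0 addr0.
pose f2l : {linear 'rV[R]_m -> F} := f2 \o inl.
have [j jE] : exists j : embedding E0 F, forall c, j (f1 c) = f2l c.
  apply: isometry_factor => // c.
  by rewrite f2N f1N /= inlE hE row_mxKl row_mxKr ntype_extends.
pose ib : {linear 'rV[R]_m -> G} := embedding_fun i \o lc b.
have [phi phiE] : exists phi : embedding E0 G, forall c, phi (f1 c) = ib c.
  by apply: isometry_factor => // c; rewrite f1N /= embedding_isometry.
pose B := \sum_(v <- L) xi v.
have B0 : 0 <= B by apply: sumr_ge0 => v _; exact: seminorm_ge0 (ntype_seminorm xi).
(* Since xi v <= B on L, an error of e * xi v is less than d there. *)
pose e := d / (2 * (B + 1)).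
have e0 : 0 < e by rewrite divr_gt0 // mulr_gt0 // ltr_wpDl.
have [psi [psij psiN]] := gG e E0 F j phi e0
  (finite_dimensional_surj f1s) (finite_dimensional_surj f2s).
exists (fun k => psi (f2 (inr (delta_mx 0 k)))) => v vL.
have /tuple.tnthP[t vE] : v \in in_tuple L by [].
pose pf : {linear 'rV[R]_n -> G} := psi \o (f2 \o inr).
have -> : tp i (fun k => psi (f2 (inr (delta_mx 0 k)))) v =
    `|psi (f2 (inl (delta_mx 0 t) + inr v.2))|.
  rewrite /= /tp_norm; congr (`|_|).
  rewrite -/(lc (fun k => pf (delta_mx 0 k)) v.2) 2!linearD /=; congr (_ + _).
    by rewrite -[f2 _]/(f2l (delta_mx 0 t)) -jE psij phiE /= lc_delta /b -vE.
  rewrite -[RHS]/(pf v.2) [in RHS](row_sum_delta v.2) linear_sum.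
  by apply: eq_bigr => k _; rewrite linearZ.
have xiv : xi v = `|f2 (inl (delta_mx 0 t) + inr v.2)|.
  rewrite f2N /= inlE inrE add_row_mx addr0 add0r hE row_mxKl row_mxKr lc_delta /b -vE.
  by case: (v).
have /andP[h1 h2] := psiN (f2 (inl (delta_mx 0 t) + inr v.2)).
rewrite -xiv in h1 h2.
have ev : e * xi v < d.
  have xB : xi v <= B.
    by apply: le_sum_mem => // w; exact: seminorm_ge0 (ntype_seminorm xi).
  apply: (@le_lt_trans _ _ (e * (B + 1))).
    by rewrite ler_wpM2l // ?(ltW e0) //; lra.
  have -> : e * (B + 1) = d / 2 by rewrite /e; field; rewrite gt_eqF // ltr_wpDl.
  by lra.
by rewrite ltr_norml; apply/andP; split; lra.
Qed.

Lemma atomic_gurarij_dense E G (i : embedding E G) n : gurarij G -> atomic_over i ->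
  dense [set xi : ntype E n | isolated_type xi].
Proof.
move=> gG at_i; apply/dense_isolatedP => xi L d d0.
have [a ad] := gurarij_types_dense i xi L gG d0.
by exists (tp i a) => //; apply/isolated_typeE; exact: at_i.
Qed.

(** * Reduction of atomicity to 1-types, and limits of isolated types *)

Lemma line_type_exists E n (xi : ntype E n) (l : 'rV[R]_n) :
  exists zeta : ntype E 1, forall b t, zeta (b, t) = xi (b, t 0 0 *: l).
Proof.
have [h hE] : exists h : {linear free_ext E 1 -> free_ext E n},
    h =1 (fun v => (v.1, v.2 0 0 *: l)).
  by apply: linear_exists => x u v; congr (_, _); rewrite /= !mxE scalerDl scalerA.
have hN b : (xi \o h) (b, 0) = `|b| by rewrite /= hE /= mxE scale0r ntype_extends.
by exists (NType (seminorm_comp h (ntype_seminorm xi)) hN) => b t /=; rewrite hE.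
Qed.

Definition line_type E n (xi : ntype E n) l : ntype E 1 :=
  sval (cid (line_type_exists xi l)).

Lemma line_typeE E n (xi : ntype E n) l b t :
  line_type xi l (b, t) = xi (b, t 0 0 *: l).
Proof. exact: (svalP (cid (line_type_exists xi l)) b t). Qed.

(** The space of directions being compact, finitely many rational lines
    determine an n-type up to e * l1 l, by [seminorm_net]; the neighbourhoods
    that isolate these finitely many 1-types are pulled back and intersected. *)
Lemma norm_isolated_lines E n (xi : ntype E n) :
  (forall g : 'rV[rat]_n, norm_isolated (line_type xi (ratr_row R g))) ->
  norm_isolated xi.
Proof.
move=> iso e e0; pose B := \sum_i xi (0, delta_mx 0 i).
have xi0 v : 0 <= xi v by exact: seminorm_ge0 (ntype_seminorm xi).
have B0 : 0 <= B by apply: sumr_ge0.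
have [s [d [d0 hs]]] := @seminorm_net R n B e B0 e0.
suff [L [r [r0 hL]]] : exists (L : seq (free_ext E n)) (r : R), 0 < r /\
    forall zeta : ntype E n, close_on L r zeta xi -> forall g, g \in s -> forall b t,
    `|zeta (b, t *: ratr_row R g) - xi (b, t *: ratr_row R g)| <= d * `|t|.
  exists L, r; split=> // zeta cl b l.
  apply: hs (hL zeta cl) b l; [exact: ntype_seminorm|exact: ntype_seminorm|move=> i].
  by rewrite /B (bigD1 i) //= lerDl sumr_ge0.
elim: s {hs} => [|g s [L [r [r0 IH]]]]; first by exists [::], 1.
have [M [c [c0 hM]]] := iso g d d0.
exists ([seq (v.1, v.2 0 0 *: ratr_row R g) | v : (E * 'rV[R]_1)%type <- M] ++ L).
exists (Num.min c r).
split; first by rewrite lt_min c0.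
move=> zeta cl g'; rewrite inE => /orP[/eqP ->|gs] b t; last first.
  apply: IH gs b t => v vL; have := cl v; rewrite mem_cat vL orbT lt_min.
  by move=> /(_ isT)/andP[].
have := hM (line_type zeta (ratr_row R g)) _ b t%:M.
rewrite !line_typeE /l1 big_ord1 !mxE eqxx !mulr1n; apply=> -[b' t'] vM.
rewrite !line_typeE.
have := cl (b', t' 0 0 *: ratr_row R g).
rewrite mem_cat lt_min => h; apply: (proj1 (andP (h _))).
by apply/orP; left; apply/mapP; exists (b', t').
Qed.

Definition tp1 E F (i : embedding E F) (g : F) : ntype E 1 := tp i (fun=> g).

Lemma tp1E E F (i : embedding E F) g b t : tp1 i g (b, t) = `|i b + t 0 0 *: g|.
Proof. by rewrite /= /tp_norm big_ord1. Qed.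

Lemma tp_isolated E F (i : embedding E F) :
  (forall g, norm_isolated (tp1 i g)) -> atomic_over i.
Proof.
move=> iso n a; apply/isolated_typeE; apply: norm_isolated_lines => g.
suff -> : line_type (tp i a) (ratr_row R g) = tp1 i (lc a (ratr_row R g)).
  exact: iso.
apply: ntype_eq => -[b t]; rewrite line_typeE tp1E /= /tp_norm /=.
by rewrite -/(lc a (t 0 0 *: ratr_row R g)) linearZ.
Qed.

Lemma l1_rV1 (t : 'rV[R]_1) : l1 t = `|t 0 0|.
Proof. by rewrite /l1 big_ord1. Qed.

(** A neighbourhood that isolates the type of g' need not be a neighbourhood
    of the type of g.  But any zeta near the type of g extends, by [open_restriction],
    to a 2-type near that of (g, g'), whose second variable has a type zeta'
    near that of g' and within |g - g'| + e / 8 of zeta.  So zeta' is close to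
    the type of g' uniformly, and zeta is close to the type of g. *)
Lemma norm_isolated_limit E F (i : embedding E F) (g : F) :
  (forall e : R, 0 < e -> exists2 g', `|g - g'| <= e & norm_isolated (tp1 i g')) ->
  norm_isolated (tp1 i g).
Proof.
move=> lim e e0; have e8 : 0 < e / 8 by rewrite divr_gt0.
have [g' gg' iso] := lim _ e8.
have [L' [d' [d'0 hL']]] := iso _ e8.
pose W := (E * 'rV[R]_1)%type; pose V := (W * 'rV[R]_1)%type.
have [T TE] : exists T : {linear W -> V}, T =1 (fun w => (w, 0)).
  by apply: linear_exists => a x y; congr (_, _); rewrite /= scaler0 addr0.
pose f : {linear V -> W} := fst.
have [h hE] : exists h : {linear V -> F},
    h =1 (fun v => i v.1.1 + v.1.2 0 0 *: g + v.2 0 0 *: g').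
  apply: linear_exists => a x y; rewrite /= linearP !mxE !scalerDl !scalerDr !scalerA.
  by rewrite [RHS]addrACA; congr (_ + _); rewrite addrACA.
have xiS := seminorm_comp h (seminorm_norm F).
have Tf : cancel T f by move=> w; rewrite TE.
(* The vector (0, 1, -1) of L controls the distance from zeta to zeta'. *)
have r0 : 0 < Num.min (d' / 2) (e / 8) by rewrite lt_min e8 divr_gt0.
pose L : seq V := (((0, 1%:M), - 1%:M) : V) :: [seq ((v.1, 0), v.2) | v <- L'].
have [M [d [d0 hM]]] := open_restriction L Tf xiS r0.
exists M, d; split=> // zeta cl b l.
have [|eta [etaS etaT etaL]] := hM zeta (ntype_seminorm zeta).
  by move=> w /cl; case: w => b' t'; rewrite tp1E /= hE TE /= mxE scale0r addr0.
have [k kE] : exists k : {linear free_ext E 1 -> V}, k =1 (fun v => ((v.1, 0), v.2)).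
  by apply: linear_exists => a x y; congr (_, _, _); rewrite /= scaler0 addr0.
have zE b' : eta ((b', 0), 0) = `|b'|.
  by rewrite -[(b', 0, 0)]TE etaT ntype_extends.
have kN b' : (eta \o k) (b', 0) = `|b'| by rewrite /= kE zE.
pose zeta' : ntype E 1 := NType (seminorm_comp k etaS) kN.
have cl' : close_on L' d' zeta' (tp1 i g').
  move=> [b' t'] vL'; rewrite tp1E /= kE /=.
  have := etaL ((b', 0), t'); rewrite inE (map_f (fun v => ((v.1, 0), v.2)) vL') orbT.
  move=> /(_ isT); rewrite /= hE /= mxE scale0r addr0 le_min => /andP[h1 _].
  by apply: le_lt_trans h1 _; lra.
have h1 := hL' zeta' cl' b l.
have h2 : `|zeta (b, l) - zeta' (b, l)| <= l1 l * (e / 4).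
  rewrite -etaT TE /= kE /= (le_trans (seminorm_dist _ _ etaS)) //.
  rewrite -[(b, l, 0) - _]/((b - b, l - 0), 0 - l) subrr subr0 add0r.
  have -> : ((0, l), - l) = l 0 0 *: ((0, 1%:M), - 1%:M) :> V.
    congr (_, _, _); rewrite /= ?scaler0 //.
      by rewrite scalemx1 -mx11_scalar.
    by rewrite scalerN scalemx1 -mx11_scalar.
  rewrite etaS.1 l1_rV1 ler_wpM2l //.
  have := etaL _ (mem_head _ _).
  rewrite le_min => /andP[_]; rewrite ler_norml => /andP[_].
  by rewrite /= hE /= !mxE linear0 add0r eqxx mulr1n scaleN1r scale1r; lra.
have h3 : `|tp1 i g' (b, l) - tp1 i g (b, l)| <= l1 l * (e / 8).
  rewrite !tp1E (le_trans (ler_dist_dist _ _)) // opprD addrACA subrr add0r -scalerBr.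
  by rewrite normrZ l1_rV1 ler_wpM2l // distrC.
have l0 : 0 <= l1 l by apply: seminorm_ge0; exact: l1_seminorm.
move: h1 h2 h3; rewrite !ler_norml => /andP[? ?] /andP[? ?] /andP[? ?].
by apply/andP; split; nra.
Qed.

End IsolatedTypes.

(** * A countable set dense for all extensions of the norm *)

Section CountableDenseSet.
Variables (R : realType) (E : completeNormedModType R).
Local Notation V := (E * {poly R})%type.

Lemma separable_sequence : separable_space E ->
  exists s : nat -> E, forall b (e : R), 0 < e -> exists n, `|b - s n| < e.
Proof.
move=> [D /countable_injP[f finj] Dd].
exists (fun n => if pselect (exists2 x, D x & f x = n) is left h
  then sval (cid2 h) else 0).
move=> b e e0.
have [||x [/interior_subset bx Dx]] := Dd (ball b e)^°.
- by exists b; exact: nbhsx_ballx.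
- exact: open_interior.
exists (f x); case: pselect => [h|]; last by case; exists x.
case: (cid2 h) => y Dy /= fyx; rewrite (finj y x) ?inE //.
by move: bx; rewrite -ball_normE.
Qed.

Definition rat_poly (s : seq rat) : {poly R} := Poly [seq ratr x | x <- s].

Lemma rat_poly_near (q : {poly R}) (e : R) : 0 < e -> exists s,
  (size (rat_poly s) <= size q)%N /\ forall i, `|q`_i - (rat_poly s)`_i| <= e.
Proof.
move=> e0.
have [r rq] := choice (fun i => rat_near q`_i e0).
exists (mkseq r (size q)); split.
  by rewrite (leq_trans (size_Poly _)) // size_map size_mkseq.
move=> i; rewrite /rat_poly coef_Poly.
have [iq|qi] := ltnP i (size q).
  by rewrite (nth_map 0) ?size_mkseq // nth_mkseq.
rewrite [q`_i]nth_default // [X in _ - X]nth_default ?size_map ?size_iota //.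
by rewrite subrr normr0 ltW.
Qed.

Variable s : nat -> E.
Hypothesis s_dense : forall b (e : R), 0 < e -> exists n, `|b - s n| < e.

Definition dense_point (k : nat * seq rat) : V := (s k.1, rat_poly k.2).

Lemma dense_point_near p v (e : R) : extends_norm p -> 0 < e ->
  exists k, p (v - dense_point k) <= e.
Proof.
case: v => b q pE e0; have e2 : 0 < e / 2 by rewrite divr_gt0.
have [n bn] := s_dense b e2.
pose B := \sum_(i < size q) p (0, 'X^i).
have B0 : 0 <= B by apply: sumr_ge0 => i _; exact: seminorm_ge0 pE.1.
have B1 : 0 < B + 1 by rewrite ltr_wpDl.
have [l [lq ql]] := @rat_poly_near q (e / 2 / (B + 1)) ltac:(by rewrite divr_gt0).
exists (n, l); rewrite -[_ - _]/(b - s n, q - rat_poly l).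
apply: le_trans (@extends_norm_le _ _ p _ _ (size q) pE _) _.
  by rewrite (leq_trans (size_polyD _ _)) // size_polyN geq_max leqnn.
rewrite (splitr e) lerD // ?(ltW bn) //.
apply: (@le_trans _ _ (e / 2 / (B + 1) * B)).
  rewrite mulr_sumr ler_sum // => i _; rewrite coefB ler_wpM2r //.
  exact: seminorm_ge0 pE.1.
by rewrite -mulrA ler_piMr ?(ltW e2) // mulrC ler_pdivrMr // mul1r; lra.
Qed.

(** Only a vector outside E can be given a prescribed 1-type over E; a small
    constant is added to those of the dense set that lie in E. *)
Lemma dense_point_near_new p v (e : R) : extends_norm p -> 0 < e ->
  exists k, (dense_point k).2 != 0 /\ p (v - dense_point k) <= e.
Proof.
move=> pE e0; have e2 : 0 < e / 2 by rewrite divr_gt0.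
have [[n l] kv] := dense_point_near v pE e2.
have [l0|l0] := eqVneq (rat_poly l) 0; last first.
  by exists (n, l); split=> //; apply: le_trans kv _; lra.
have P0 : 0 <= p (0, 1) by exact: seminorm_ge0 pE.1.
have P1 : 0 < p (0, 1) + 1 by rewrite ltr_wpDl.
have [r] := @rat_in_itvoo R 0 (e / 2 / (p (0, 1) + 1)) ltac:(by rewrite divr_gt0).
rewrite in_itv /= => /andP[r0 re].
have r0' : 0 < ratr r :> R by exact: r0.
have rE : rat_poly [:: r] = ratr r *: 1.
  by rewrite /rat_poly /= cons_poly_def mul0r add0r alg_polyC.
have pE' : dense_point (n, [:: r]) = dense_point (n, l) + ratr r *: (0, 1).
  by rewrite /dense_point /= l0 rE; congr (_, _); rewrite /= ?scaler0 ?addr0 ?add0r.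
exists (n, [:: r]); split.
  by rewrite /dense_point /= rE scaler_eq0 oner_eq0 orbF gt_eqF.
rewrite pE' opprD addrA (splitr e) (le_trans (pE.1.2 _ _)) // lerD //.
rewrite (seminormN _ pE.1) pE.1.1 gtr0_norm //.
apply: (@le_trans _ _ (e / 2 / (p (0, 1) + 1) * p (0, 1))).
  by rewrite ler_wpM2r // ltW.
by rewrite -mulrA ler_piMr ?(ltW e2) // mulrC ler_pdivrMr // mul1r; lra.
Qed.

End CountableDenseSet.

(** * Generic extensions of the norm *)

Section Generic.
Variables (R : realType) (E : completeNormedModType R) (s : nat -> E).
Local Notation V := (E * {poly R})%type.
Local Notation D := (dense_point s).
Local Notation I := (nat * seq rat)%type.

Definition line_map (v : V) (w : free_ext E 1) : V :=
  (w.1 + w.2 0 0 *: v.1, w.2 0 0 *: v.2).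

Arguments line_map : simpl never.

Lemma line_map_linear v : linear (line_map v).
Proof.
move=> a x y; congr (_, _); rewrite /= !mxE scalerDl -scalerA //.
by rewrite scalerDr addrACA.
Qed.

HB.instance Definition _ v :=
  GRing.isLinear.Build R (free_ext E 1) V *:%R (line_map v) (line_map_linear v).

Lemma line_mapE v (b : E) (t : 'rV[R]_1) : line_map v (b, t) = (b, 0) + t 0 0 *: v.
Proof. by congr (_, _); rewrite /= add0r. Qed.

(** The dense vector with index k has an isolated type when this holds for all m.
    Each condition is open, whereas isolation is a countable intersection. *)
Definition isolation_condition (k : I) (m : nat) (p : V -> R) : Prop :=
  exists (L : seq (free_ext E 1)) (d : R), 0 < d /\
  forall z1 z2 : ntype E 1,
    close_on L d z1 (p \o line_map (D k)) -> close_on L d z2 (p \o line_map (D k)) ->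
  forall b t, `|z1 (b, t) - z2 (b, t)| <= m.+1%:R^-1 * l1 t.

(** The list a is a finite description of the space spanned by dense vectors and
    n new vectors.  With rational coefficients and values there are countably
    many such descriptions. *)
Definition extension_condition (n : nat) (a : seq (I * 'rV[rat]_n * rat)) (m : nat)
    (p : V -> R) : Prop :=
  exists w : 'I_n -> V, forall x, x \in a ->
    `|p (D x.1.1 + lc w (ratr_row R x.1.2)) - ratr x.2| < m.+1%:R^-1.

Lemma isolation_condition_open k m : open_condition (isolation_condition k m).
Proof.
move=> p pE [L [d [d0 h]]].
have d2 : 0 < d / 2 by rewrite divr_gt0.
exists [seq line_map (D k) w | w <- L], (d / 2); split=> // q qE qp.
have tri z : close_on L (d / 2) z (q \o line_map (D k)) ->
    close_on L d z (p \o line_map (D k)).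
  move=> zq w wL; have h1 := zq w wL; have h2 := qp _ (map_f (line_map (D k)) wL).
  by rewrite (le_lt_trans (ler_distD (q (line_map (D k) w)) _ _)) // (splitr d) ltrD.
by exists L, (d / 2); split=> // z1 z2 /tri h1 /tri h2; exact: h.
Qed.

Lemma extension_condition_open n a m : open_condition (@extension_condition n a m).
Proof.
move=> p pE [w hw]; have [r [r0 hr]] := margin hw.
exists [seq D x.1.1 + lc w (ratr_row R x.1.2) | x <- a], r; split=> // q qE qp.
exists w => x xa; apply: lt_le_trans (hr x xa).
rewrite (le_lt_trans (ler_distD (p (D x.1.1 + lc w (ratr_row R x.1.2))) _ _)) //.
rewrite addrC ltrD2l; apply: qp.
by apply/mapP; exists x.
Qed.

Lemma generic_exists : exists p : V -> R, [/\ extends_norm p,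
  forall k m, adherent (isolation_condition k m) p -> isolation_condition k m p &
  forall n a m, adherent (@extension_condition n a m) p ->
    @extension_condition n a m p].
Proof.
pose J := ((I * nat) + {n : nat & seq (I * 'rV[rat]_n * rat)} * nat)%type.
pose O (j : J) := match j with
  | inl km => isolation_condition km.1 km.2
  | inr am => @extension_condition (tag am.1) (tagged am.1) am.2 end.
pose On n := if unpickle n is Some j then O j else fun=> True.
have Oop n : open_condition (On n).
  rewrite /On; case: unpickle => [[km|am]|]; last by exists [::], 1.
    exact: isolation_condition_open.
  exact: extension_condition_open.
pose p0 (v : V) := `|v.1|.
have p0E : extends_norm p0.
  pose f : {linear V -> E} := fst.
  by split=> //; exact: (seminorm_comp f (seminorm_norm E)).
have [p [pE pO]] := generic_norm p0E Oop.
have pj (j : J) : adherent (O j) p -> O j p.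
  by have := pO (pickle j); rewrite /On pickleK.
exists p; split=> // [k m|n a m]; first exact: (pj (inl (k, m))).
exact: (pj (inr (existT (fun n => seq (I * 'rV[rat]_n * rat)) n a, m))).
Qed.

(** As the polynomial part of the dense vector is not 0, the line through it is
    a direct factor over E, with projection f built from the leading
    coefficient.  Thus [open_restriction] transfers an isolated 1-type near the
    type of this vector to an extension of the norm near p. *)
Lemma isolation_condition_adherent k m p :
    (forall (xi : ntype E 1) L (d : R), 0 < d ->
      exists2 zeta : ntype E 1, norm_isolated zeta & close_on L d zeta xi) ->
    extends_norm p -> (D k).2 != 0 ->
  adherent (isolation_condition k m) p.
Proof.
move=> iso pE k0 L d d0; set v := D k.
pose i := (size v.2).-1.
have vi : v.2`_i != 0 by rewrite -lead_coefE lead_coef_eq0.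
pose c (q : {poly R}) : R := q`_i / v.2`_i.
have cl : scalar c by move=> a x y; rewrite /c coefD coefZ mulrDl mulrA.
have [f fE] : exists f : {linear V -> free_ext E 1},
    f =1 (fun x => (x.1 - c x.2 *: v.1, (c x.2)%:M)).
  apply: linear_exists => a x y; congr (_, _); rewrite /= cl.
    by rewrite scalerDl opprD addrACA scalerBr scalerA.
  by rewrite raddfD /= -[(a * _)%:M]scale_scalar_mx.
have Tf : cancel (line_map v) f.
  move=> [b t]; rewrite fE /line_map /=.
  have -> : c (t 0 0 *: v.2) = t 0 0 by rewrite /c coefZ mulfK.
  by rewrite addrK -mx11_scalar.
have d2 : 0 < d / 2 by rewrite divr_gt0.
have [L' [d' [d'0 hL']]] := open_restriction L Tf pE.1 d2.
have hN b : (p \o line_map v) (b, 0) = `|b|.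
  by rewrite /= line_mapE mxE scale0r addr0 pE.2.
pose xi : ntype E 1 := NType (seminorm_comp (line_map v) pE.1) hN.
have [eta etaI etaxi] := iso xi L' d' d'0.
have [z [zS zT zL]] := hL' eta (ntype_seminorm eta) etaxi.
exists z; split=> [||].
- split=> // b; have := zT (b, 0).
  by rewrite ntype_extends /= line_mapE mxE scale0r addr0.
- by move=> w wL; apply: le_lt_trans (zL w wL) _; lra.
have m0 : 0 < m.+1%:R^-1 / 2 :> R by rewrite divr_gt0 ?invr_gt0.
have [M [r [r0 hM]]] := etaI _ m0.
exists M, r; split=> // z1 z2 h1 h2 b t.
have e1 : close_on M r z1 eta by move=> w /h1; rewrite /= zT.
have e2 : close_on M r z2 eta by move=> w /h2; rewrite /= zT.
have := hM z1 e1 b t; have := hM z2 e2 b t; rewrite !ler_norml.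
move: (m.+1%:R^-1) => c' /andP[? ?] /andP[? ?].
by apply/andP; split; nra.
Qed.

(** The monomials of degrees d, ..., d + n - 1 serve as the new variables of N,
    and those of higher degrees are sent to 0. *)
Lemma extends_norm_room (p : V -> R) n (N : V * 'rV[R]_n -> R) d : extends_norm p ->
  seminorm N -> (forall v : V, N (v, 0) = p v) ->
  exists (z : V -> R) (w : 'I_n -> V), extends_norm z /\
    forall (v : V) (t : 'rV[R]_n), (size v.2 <= d)%N -> z (v + lc w t) = N (v, t).
Proof.
move=> pE NS Np.
have [T TE] : exists T : {linear V -> (V * 'rV[R]_n)%type},
    T =1 (fun v => ((v.1, take_poly d v.2), \row_(i < n) v.2`_(d + i))).
  apply: linear_exists => a x y; congr (_, _, _); rewrite ?linearP //.
  by apply/rowP => i; rewrite !mxE coefD coefZ.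
exists (N \o T), (fun i => (0, 'X^(d + i))); split.
  split=> [|b]; first exact: seminorm_comp.
  rewrite /= TE /= take_poly0r -pE.2 -Np; congr (N (_, _)).
  by apply/rowP => i; rewrite !mxE coef0.
move=> v t vd; rewrite /= linearD lc_linear (TE v) /= take_poly_id //.
have -> : \row_(i < n) v.2`_(d + i) = 0.
  by apply/rowP => i; rewrite !mxE nth_default // (leq_trans vd) // leq_addr.
have -> : lc (T \o (fun i : 'I_n => (0, 'X^(d + i)))) t = (0, t).
  have [g gE] : exists g : {linear 'rV[R]_n -> (V * 'rV[R]_n)%type},
      g =1 (fun t => (0, t)).
    by apply: linear_exists => a x y; congr (_, _); rewrite /= scaler0 addr0.
  rewrite -gE [in RHS](row_sum_delta t) linear_sum; apply: eq_bigr => i _.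
  rewrite linearZ; congr (_ *: _); rewrite /= gE TE /=.
  rewrite addnC exprD take_polyMXn_0; congr (_, _).
  by apply/rowP => j; rewrite !mxE -exprD addnC coefXn eqn_add2l eqxx.
by congr N; rewrite -[LHS]/(_ + _, _ + _) addr0 add0r; case: (v).
Qed.

End Generic.

Section GenericExtension.
Variables (R : realType) (E : completeNormedModType R) (s : nat -> E).
Local Notation V := (E * {poly R})%type.
Local Notation D := (dense_point s).
Local Notation I := (nat * seq rat)%type.

(** A finite list only involves polynomials of bounded degree, so the amalgam of
    p and q can be installed on the next monomials without changing p on it. *)
Lemma extension_condition_adherent (p : V -> R) k n (d : 'I_k -> V)
    (q : 'rV[R]_k * 'rV[R]_n -> R) (t : R) (a : seq (I * 'rV[rat]_n * rat)) m :
    extends_norm p -> seminorm q -> 0 <= t ->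
    (forall c, `|p (lc d c) - q (c, 0)| <= t * l1 c) ->
    (forall x, x \in a -> exists c, p (D x.1.1 - lc d c) + t * l1 c +
       `|q (c, ratr_row R x.1.2) - ratr x.2| < m.+1%:R^-1) ->
  adherent (extension_condition s a m) p.
Proof.
move=> pE qS t0 close ha L r r0.
have [N [NS Np Nq]] := extension_amalgam pE.1 qS t0 close.
pose sz := (\max_(v <- L) size v.2 + \max_(x <- a) size (D x.1.1).2)%N.
have [z [w [zE zw]]] := extends_norm_room sz pE NS Np.
exists z; split=> // [v vL|].
  have := zw v 0; rewrite (linear0 (lc w)) addr0 Np => ->.
    by rewrite subrr normr0.
  rewrite (leq_trans _ (leq_addr _ _)) //.
  exact: (@leq_bigmax_seq _ _ predT (fun v : V => size v.2)).
exists w => x xa; have [c hc] := ha x xa.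
rewrite zw; last first.
  rewrite (leq_trans _ (leq_addl _ _)) //.
  exact: (@leq_bigmax_seq _ _ predT (fun x : I * 'rV[rat]_n * rat => size (D x.1.1).2)).
apply: le_lt_trans hc; set y := ratr_row R x.1.2.
have h1 : `|N (D x.1.1, y) - N (lc d c, y)| <= p (D x.1.1 - lc d c).
  apply: le_trans (seminorm_dist _ _ NS) _.
  by rewrite -[(D x.1.1, y) - _]/(D x.1.1 - lc d c, y - y) subrr Np.
rewrite (le_trans (ler_distD (q (c, y)) _ _)) // lerD2r.
by rewrite (le_trans (ler_distD (N (lc d c, y)) _ _)) // lerD.
Qed.

Hypothesis s_dense : forall b (e : R), 0 < e -> exists n, `|b - s n| < e.

(** Let h be a basis of F0 over E0 and u a basis of E0.  The unit ball of the
    coefficient space being compact, it suffices to find images of h for which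
    the norms agree, up to a small error, on finitely many rational
    combinations of u and h.  The vectors phi (u i) of G are approximated by
    vectors d i of E * {poly R}, and their combinations by dense vectors; this
    turns the requirement into an extension condition to which p is adherent,
    the amalgam being taken along u and d.  Only the images of h are
    approximate, so psi extends phi exactly. *)
Lemma generic_gurarij (p : V -> R) (G : completeNormedModType R) (f : {linear V -> G}) :
    extends_norm p ->
    (forall n a m, adherent (@extension_condition R E s n a m) p ->
      extension_condition s a m p) ->
    (forall v, `|f v| = p v) ->
    (forall g (e : R), 0 < e -> exists v, `|g - f v| <= e) ->
  gurarij G.
Proof.
move=> pE pX fN fd e E0 F0 j phi e0 E0fd F0fd.
have [k [u [uspan uind]]] : exists k (u : 'I_k -> E0),
    (forall x, exists c, x = lc u c) /\ (forall c, lc u c = 0 -> c = 0).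
  pose z0 : {linear E0 -> E0} := \0; pose id0 : {linear E0 -> E0} := idfun.
  have [|k [u [h1 h2]]] := @relative_basis R E0 E0 E0 z0 id0.
    have [n [v hv]] := E0fd; exists n, v => x; have [c ->] := hv x.
    exists 0, (\row_i c i); rewrite /= add0r; apply: eq_bigr => i _.
    by rewrite mxE.
  exists k, u; split=> [x|c hc]; last by apply: (h2 0); rewrite /= add0r.
  by have [w [c hc]] := h1 x; exists c; rewrite /= add0r in hc.
have [n [h [hspan hind]]] : exists n (h : 'I_n -> F0),
    (forall y, exists x c, y = j x + lc h c) /\
    (forall x c, j x + lc h c = 0 -> c = 0).
  pose id0 : {linear F0 -> F0} := idfun.
  apply: (@relative_basis R E0 F0 F0 j id0).
  have [n [v hv]] := F0fd; exists n, v => x; have [c ->] := hv x.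
  exists 0, (\row_i c i); rewrite /= linear0 add0r; apply: eq_bigr => i _.
  by rewrite mxE.
pose W := 'rV[R]_(k + n).
pose Q (c : 'rV[R]_k * 'rV[R]_n) := j (lc u c.1) + lc h c.2.
have Qlin : linear Q by move=> a x y; rewrite /Q !linearP /= scalerDr addrACA.
have [Q' QE] := linear_exists Qlin.
pose q c := `|Q' c|.
have qS : seminorm q := seminorm_comp Q' (seminorm_norm F0).
have [Phi PhiE] : exists Phi : {linear W -> F0},
    Phi =1 (fun c => Q (lsubmx c, rsubmx c)).
  apply: linear_exists => a x y; rewrite -Qlin; congr Q.
  by congr (_, _); rewrite linearP.
have Phi_inj c : Phi c = 0 -> c = 0.
  rewrite PhiE /Q /= => hc; have c2 := hind _ _ hc.
  have c1 : lsubmx c = 0.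
    apply: uind; apply/eqP; rewrite -normr_eq0 -(embedding_isometry j).
    by move: hc; rewrite c2 linear0 addr0 => ->; rewrite normr0.
  by rewrite -[c]hsubmxK c1 c2 row_mx0.
have Phi_surj y : exists c, y = Phi c.
  have [x [c2 ->]] := hspan y; have [c1 ->] := uspan x.
  by exists (row_mx c1 c2); rewrite PhiE /Q /= row_mxKl row_mxKr.
have [C C0 hC] := l1_le_norm Phi_inj.
pose B := \sum_i `|Phi (delta_mx 0 i)|.
have B0 : 0 <= B by apply: sumr_ge0 => i _; exact: normr_ge0.
have eC : 0 < e / C by rewrite divr_gt0.
have [net [dl [dl0 hnet]]] := @seminorm_net_rV R (k + n) B (e / C) B0 eC.
(* Errors of at most mu / 4 arise from t, from the dense vectors and from the
   rational values; with mu <= dl / 4 they and the error mu of the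
   extension condition add up to less than dl. *)
have [m hm] := @invS_le R (dl / 4) ltac:(by rewrite divr_gt0).
have mu0 : 0 < m.+1%:R^-1 :> R by rewrite invr_gt0.
set mu := m.+1%:R^-1 in hm mu0.
pose La := \sum_(g <- net) l1 (ratr_row R g).
have l10 N (c : 'rV[R]_N) : 0 <= l1 c by apply: seminorm_ge0; exact: l1_seminorm.
have La0 : 0 <= La by apply: sumr_ge0.
pose t := mu / 4 / (La + 1).
have t0 : 0 < t by rewrite !divr_gt0 // ltr_wpDl.
have [d hd] := choice (fun i => fd (phi (u i)) t t0).
have fdu c : `|phi (lc u c) - f (lc d c)| <= t * l1 c.
  rewrite (lc_linear phi) (lc_linear f).
  by apply: (@lc_dist _ _ _ (embedding_fun phi \o u) (f \o d)) => i; exact: hd.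
have close c : `|p (lc d c) - q (c, 0)| <= t * l1 c.
  rewrite -fN /q QE /Q /= linear0 addr0 embedding_isometry.
  rewrite -(embedding_isometry phi) distrC.
  by rewrite (le_trans (ler_dist_dist _ _)).
have mu4 : 0 < mu / 4 by rewrite divr_gt0.
pose c1 g := ratr_row R (lsubmx (g : 'rV[rat]_(k + n))).
pose c2 g := ratr_row R (rsubmx (g : 'rV[rat]_(k + n))).
have [kk hkk] := choice (fun g => dense_point_near s_dense (lc d (c1 g)) pE mu4).
have [r hr] := choice (fun g => rat_near (q (c1 g, c2 g)) mu4).
have tg g : g \in net -> t * l1 (c1 g) <= mu / 4.
  move=> gn; apply: (@le_trans _ _ (t * (La + 1))).
    have gLa : l1 (ratr_row R g) <= La.
      exact: (le_sum_mem (f := fun g => l1 (ratr_row R g))).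
    rewrite ler_wpM2l ?(ltW t0) //.
    apply: (@le_trans _ _ (l1 (ratr_row R g))); last lra.
    rewrite /l1 big_split_ord /=; apply: ler_wpDr; first exact: sumr_ge0.
    by apply: ler_sum => i _; rewrite !mxE.
  by rewrite /t divfK // gt_eqF // ltr_wpDl.
pose data := [seq ((kk g, rsubmx g), r g) | g <- net].
have [w hw] : extension_condition s data m p.
  apply: pX; apply: (extension_condition_adherent pE qS (ltW t0) close).
  move=> _ /mapP[g gn ->] /=; exists (c1 g); rewrite (seminormC _ _ pE.1).
  by have := hkk g; have := hr g; have := tg g gn; rewrite -/mu -/(c2 g); lra.
have [Psi PsiE] : exists Psi : {linear W -> G},
    Psi =1 (fun c => phi (lc u (lsubmx c)) + f (lc w (rsubmx c))).
  by apply: linear_exists => a x y; rewrite !linearP /= scalerDr addrACA.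
have PP c : `| `|Psi c| - `|Phi c| | <= e / C * l1 c.
  apply: (hnet _ _ (seminorm_comp Psi (seminorm_norm G))
    (seminorm_comp Phi (seminorm_norm F0))).
    move=> i; rewrite /B (bigD1 i) //= lerDl.
    by apply: sumr_ge0 => i' _; exact: normr_ge0.
  move=> g gn /=.
  have h1 : `|Phi (ratr_row R g)| = q (c1 g, c2 g).
    by rewrite PhiE /q QE /c1 /c2 /ratr_row map_lsubmx map_rsubmx.
  have h2 : Psi (ratr_row R g) = phi (lc u (c1 g)) + f (lc w (c2 g)).
    by rewrite PsiE /c1 /c2 /ratr_row map_lsubmx map_rsubmx.
  have h3 : `| `|Psi (ratr_row R g)| - p (D (kk g) + lc w (c2 g)) | <= mu / 4 + mu / 4.
    rewrite -fN (le_trans (ler_dist_dist _ _)) // h2 linearD.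
    rewrite opprD addrACA subrr addr0.
    rewrite (le_trans (ler_distD (f (lc d (c1 g))) _ _)) // lerD //.
      exact: le_trans (fdu _) (tg g gn).
    by rewrite -linearB fN.
  have h4 : `|p (D (kk g) + lc w (c2 g)) - ratr (r g)| < mu.
    by apply: (hw ((kk g, rsubmx g), r g)); apply/mapP; exists g.
  move: (hr g) h3 h4; rewrite h1 !ler_norml ltr_norml.
  by move=> /andP[? ?] /andP[? ?] /andP[? ?]; apply/andP; split; lra.
have [psi psiE] : exists psi : {linear F0 -> G}, forall c, psi (Phi c) = Psi c.
  apply: linear_factor => // c /Phi_inj ->; exact: linear0.
exists psi; split=> [x|y].
  have [c ->] := uspan x.
  have -> : j (lc u c) = Phi (row_mx c 0).
    by rewrite PhiE /Q /= row_mxKl row_mxKr linear0 addr0.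
  by rewrite psiE PsiE row_mxKl row_mxKr !linear0 addr0.
have [c ->] := Phi_surj y; rewrite psiE.
have h1 : e / C * l1 c <= e * `|Phi c|.
  by rewrite -mulrA ler_wpM2l ?(ltW e0) // mulrC ler_pdivrMr // mulrC.
have := le_trans (PP c) h1; rewrite ler_norml => /andP[? ?].
by apply/andP; split; lra.
Qed.

End GenericExtension.

(** G is the completion of a generic p; elements of G are approximated by dense
    vectors with nonzero polynomial part, whose types are isolated. *)
Lemma dense_isolated1_atomic (R : realType) (E : completeNormedModType R) :
  separable_space E -> dense [set xi : ntype E 1 | isolated_type xi] ->
  exists (G : completeNormedModType R) (i : embedding E G),
    [/\ separable_space G, gurarij G & atomic_over i].
Proof.
move=> /separable_sequence[s sd] /dense_isolatedP iso.
have [p [pE pI pX]] := generic_exists s.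
have [G [f [fN fd]]] := completion_exists pE.1.
have [i0 i0E] : exists i0 : {linear E -> G}, i0 =1 (fun b => f (b, 0)).
  apply: linear_exists => a x y; rewrite -linearP; congr (f (_, _)).
  by rewrite /= scaler0 addr0.
have iN b : `|i0 b| = `|b| by rewrite i0E fN pE.2.
pose i := Embedding iN.
have near g (e : R) : 0 < e ->
    exists k, (dense_point s k).2 != 0 /\ `|g - f (dense_point s k)| <= e.
  move=> e0; have e2 : 0 < e / 2 by rewrite divr_gt0.
  have [v gv] := fd g _ e2; have [k [k0 kv]] := dense_point_near_new sd v pE e2.
  exists k; split=> //; rewrite (le_trans (ler_distD (f v) _ _)) // (splitr e) lerD //.
  by rewrite -linearB fN.
exists G, i; split.
- exists (range (f \o dense_point s)).
    apply: (sub_countable (card_image_le _ _)); exact: countableP.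
  move=> U [g Ug] Uop.
  have /nbhs_ballP[e /= e0 eU] : nbhs g U by exact: open_nbhs_nbhs.
  have [k [_ gk]] := near g (e / 2) ltac:(by rewrite divr_gt0).
  exists (f (dense_point s k)); split; last by exists k.
  by apply: eU; rewrite -ball_normE /= (le_lt_trans gk) //; lra.
- exact: (generic_gurarij sd pE pX fN fd).
- apply: tp_isolated => g; apply: norm_isolated_limit => e e0.
  have [k [k0 gk]] := near g e e0; exists (f (dense_point s k)) => //.
  move=> r r0; have [m hm] := invS_le r0.
  have [L [d [d0 hL]]] := pI k m (@isolation_condition_adherent _ _ _ k m p iso pE k0).
  have self v : tp1 i (f (dense_point s k)) v = p (line_map (dense_point s k) v).
    case: v => b t; rewrite tp1E line_mapE -fN linearD linearZ /=.
    by rewrite i0E.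
  exists L, d; split=> // z zL b l.
  apply: le_trans (hL z (tp1 i (f (dense_point s k))) _ _ b l) _.
  + by move=> v /zL; rewrite self.
  + by move=> v _; rewrite /= -self subrr normr0.
  + by rewrite ler_wpM2r //; apply: seminorm_ge0; exact: l1_seminorm.
Qed.

Theorem theorem2p16 (R : realType) (E : completeNormedModType R)
    (hE : separable_space E) :
  [<-> exists (G : completeNormedModType R) (i : embedding E G),
         [/\ separable_space G, gurarij G & atomic_over i];
       forall n : nat, dense [set xi : ntype E n | isolated_type xi];
       dense [set xi : ntype E 1 | isolated_type xi]].
Proof.
tfae.
- move=> [G [i [_ gG at_i]]] n; exact: atomic_gurarij_dense gG at_i.
- by move=> h; exact: h.
- exact: dense_isolated1_atomic.
Qed.
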